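(* Let $d\ge 1$ be an integer and let $$1\le p_k\le q_k<\infty,\qquad \alpha_k>-\frac1{q_k},\qquad k=1,\dots,d,$$ and define $$\beta_k=1-\frac1{p_k}-\frac1{q_k}-\alpha_k,\qquad k=1,\dots,d.$$ Let $K\ge 1$, $\lambda\in[1,\infty)^d$, let $g\in\mathrm{RMGM}(K,\lambda)$, and let $f$ be its coordinatewise even extension to $\mathbb R^d$. If $\Pi_\beta f\in L_{\vec p}(\mathbb R^d)$, then $$\|\Pi_\alpha\widehat f_A\|_{L_{\vec q}(\mathbb R^d)}\le C\,\|\Pi_\beta f\|_{L_{\vec p}(\mathbb R^d)},$$ where the constant $C$ depends only on $d,\vec p,\vec q,\alpha,K$ and $\lambda$. If $f\in L^1(\mathbb R^d)$, the Abel transform $\widehat f_A$ in this inequality may be replaced by the ordinary Fourier transform $\widehat f(\xi)=\int_{\mathbb R^d}e^{ix\cdot\xi}f(x)\,dx$.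
   Context: Products, quotients and inequalities of vectors are componentwise. For $r\in(0,\infty)^d$ put $\mathcal Q(r)=\prod_{k=1}^d(0,r_k)$ and $\mathcal Q^*(r)=\prod_{k=1}^d[r_k,\infty)$. Upper-tail potentials. A complex Radon measure on $(0,\infty)^d$ is understood locally (its total variation $|\mu|$ is finite on compact sets but not necessarily on the whole space). A measurable function $g:(0,\infty)^d\to\mathbb C$ is an upper-tail potential if there is a complex Radon measure $\mu_g$ on $(0,\infty)^d$ such that $g(x)=\mu_g(\mathcal Q^*(x))$ for almost every $x$ and $$\mathcal M_g(r):=\int_{(0,\infty)^d}\prod_{k=1}^d\min\{r_k,t_k\}\,d|\mu_g|(t)<\infty\quad\text{for every }r\in(0,\infty)^d.$$ The second condition implies $|\mu_g|(\mathcal Q^*(x))<\infty$ for every $x$. The measure $\mu_g$ is uniquely determined by the almost-everywhere class of $g$, and $g$ is always represented by its canonical version $g(x)=\mu_g(\mathcal Q^*(x))$ for every $x$. RMGM. For $K\ge1$ and $\lambda\in[1,\infty)^d$, an upper-tail potential $g$ belongs to $\mathrm{RMGM}(K,\lambda)$ if $\mathcal M_g(r)\le K\int_{\mathcal Q(\lambda r)}|g(x)|\,dx$ for every $r\in(0,\infty)^d$. Even extension. $f(x)=g(|x_1|,\dots,|x_d|)$ when $x_1\cdots x_d\ne0$; the values on the coordinate hyperplanes are arbitrary measurable values (irrelevant almost everywhere). Abel Fourier transform. For $\varepsilon\in(0,\infty)^d$ put $\widehat f_\varepsilon(\xi)=\int_{\mathbb R^d}f(x)e^{-\sum_k\varepsilon_k|x_k|}e^{ix\cdot\xi}\,dx$.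 For $\xi$ with no zero coordinate, $\widehat f_A(\xi)=\lim_{\varepsilon\to0+}\widehat f_\varepsilon(\xi)$, where all $\varepsilon_k\downarrow0$ along an arbitrary path (the limit being independent of the path); this limit exists for even extensions of upper-tail potentials. If some $\xi_k=0$, set $\widehat f_A(\xi)=0$. Weights and mixed norms. For $\rho\in\mathbb R^d$, $\Pi_\rho(x)=\prod_k|x_k|^{\rho_k}$ if $x_1\cdots x_d\neq0$, and $\Pi_\rho(x)=0$ on the coordinate hyperplanes. For $\vec s=(s_1,\dots,s_d)$ with $1\le s_k<\infty$, $$\|F\|_{L_{\vec s}(\mathbb R^d)}=\left(\int_{\mathbb R}\cdots\left(\int_{\mathbb R}|F(x_1,\dots,x_d)|^{s_1}\,dx_1\right)^{s_2/s_1}\cdots dx_d\right)^{1/s_d}$$ (the $x_1$ integral is innermost, $x_d$ outermost). *)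

(* Defs.v *)
From HB Require Import structures.
From mathcomp Require Import all_boot all_order all_algebra.
From mathcomp Require Import complex.
From mathcomp Require Import all_classical all_reals all_analysis.

Set Implicit Arguments.
Unset Strict Implicit.
Unset Printing Implicit Defensive.

Import Order.TTheory GRing.Theory Num.Theory.
Import numFieldNormedType.Exports.

Local Open Scope classical_set_scope.
Local Open Scope ring_scope.
Local Open Scope complex_scope.

(** R^d, with its Borel (product) sigma-algebra.  The factors are
    [measurableTypeR R] (an alias of [R]) because that is the type on which
    [lebesgue_measure] is defined; [ecoord] and [evec] hide the alias. *)
Notation euc R d := (d.-tuple (measurableTypeR R)).

Notation cabs := ComplexField.Normc.normc.

Definition ecoord {R : realType} {d} (x : euc R d) (k : 'I_d) : R := tnth x k.

Definition evec {R : realType} {d} (F : 'I_d -> R) : euc R d :=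
  [tuple F k | k < d].

(** Lebesgue measure on R^(n+1): the image of the product measure on R * R^n
    under (x, y) |-> x :: y. *)
Section lebesgue_cons.
Context {R : realType} (n : nat).

Definition consp (z : measurableTypeR R * euc R n) : euc R n.+1 :=
  cons_tuple z.1 z.2.

Lemma measurable_consp :
  measurable_fun [set: measurableTypeR R * euc R n] consp.
Proof.
by apply: (measurable_cons (f := fst) (g := snd));
  [exact: measurable_fst|exact: measurable_snd].
Qed.

Variable m : {sigma_finite_measure set (euc R n) -> \bar R}.

Definition leb_cons : set (euc R n.+1) -> \bar R :=
  pushforward (@lebesgue_measure R \x m)%E consp.

Let leb_cons0 : leb_cons set0 = 0%E.
Proof. by rewrite /leb_cons /pushforward preimage_set0 measure0. Qed.

Let leb_cons_ge0 A : (0 <= leb_cons A)%E.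
Proof. by rewrite /leb_cons /pushforward; apply: measure_ge0. Qed.

Let leb_cons_additive : semi_sigma_additive leb_cons.
Proof.
move=> F mF tF mUF; rewrite /leb_cons /pushforward preimage_bigcup.
apply: measure_semi_sigma_additive.
- by move=> i; rewrite -[X in measurable X]setTI; exact: measurable_consp.
- apply/trivIsetP => /= i j _ _ ij; rewrite -preimage_setI.
  by move/trivIsetP : tF => /(_ _ _ _ _ ij) ->//; rewrite preimage_set0.
- by rewrite -preimage_bigcup -[X in measurable X]setTI; exact: measurable_consp.
Qed.

HB.instance Definition _ := isMeasure.Build _ _ _ leb_cons
  leb_cons0 leb_cons_ge0 leb_cons_additive.

Let uncons (x : euc R n.+1) : measurableTypeR R * euc R n :=
  (thead x, [tuple of behead x]).

Let measurable_uncons : measurable_fun [set: euc R n.+1] uncons.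
Proof.
apply/measurable_fun_pairP; split.
- exact: (measurable_tnth ord0).
- exact: measurable_behead.
Qed.

Let leb_cons_sigma_finite : sigma_finite setT leb_cons.
Proof.
have /sigma_finiteP[F [TF ndF Foo]] := sigma_finiteT (@lebesgue_measure R).
have /sigma_finiteP[G [TG ndG Goo]] := sigma_finiteT m.
exists (fun i => uncons @^-1` (F i `*` G i)).
  apply/esym/seteqP; split => // x _.
  have [i _ Fi] : (\bigcup_i F i) (uncons x).1 by rewrite -TF.
  have [j _ Gj] : (\bigcup_i G i) (uncons x).2 by rewrite -TG.
  exists (maxn i j) => //; split.
  - by move: Fi; exact/subsetPset/ndF/leq_maxl.
  - by move: Gj; exact/subsetPset/ndG/leq_maxr.
move=> i; have [mF Fioo] := Foo i; have [mG Gioo] := Goo i; split.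
  rewrite -[X in measurable X]setTI.
  by apply: measurable_uncons => //; exact: measurableX.
rewrite /leb_cons /pushforward -comp_preimage.
have -> : uncons \o consp = id.
  by apply/funext => -[x y]; congr pair => //; exact/val_inj.
by rewrite preimage_id product_measure1E// lte_mul_pinfty// ge0_fin_numE.
Qed.

HB.instance Definition _ := Measure_isSigmaFinite.Build _ _ _ leb_cons
  leb_cons_sigma_finite.

End lebesgue_cons.

Fixpoint lebesgue {R : realType} (n : nat) :
    {sigma_finite_measure set (euc R n) -> \bar R} :=
  match n with
  | 0 => \d_([tuple] : euc R 0)
  | n'.+1 => leb_cons (lebesgue n')
  end.

Section boxes.
Context {R : realType} {d : nat}.
Implicit Types r a b x : euc R d.

Definition orthant : set (euc R d) := [set x | forall k, 0 < ecoord x k].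

Definition Qbox r : set (euc R d) :=
  [set x | forall k, 0 < ecoord x k < ecoord r k].

Definition Qstar r : set (euc R d) :=
  [set x | forall k, ecoord r k <= ecoord x k].

Definition cbox a b : set (euc R d) :=
  [set x | forall k, ecoord a k <= ecoord x k <= ecoord b k].

(** A set is relatively compact in (0, oo)^d iff it lies in some closed box
    [a, b] with a in (0, oo)^d. *)
Definition relcompact (E : set (euc R d)) :=
  exists a b, orthant a /\ E `<=` cbox a b.

End boxes.

Section radon.
Context {R : realType} {d : nat}.

(** Real and imaginary parts are given by their Jordan decompositions into
    mutually singular positive Radon measures.  As (0, oo)^d is locally
    compact and second countable, a positive Radon measure on it is a Borel
    measure finite on relatively compact sets.  The measures live on R^d for
    convenience; only their restrictions to (0, oo)^d are ever used. *)
Definition positive_radon (m : set (euc R d) -> \bar R) :=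
  forall E, measurable E -> relcompact E -> (m E < +oo)%E.

Definition singular_on_orthant (m n : set (euc R d) -> \bar R) :=
  exists2 A, measurable A & m (orthant `\` A) = 0%E /\ n (orthant `&` A) = 0%E.

Record complex_radon := ComplexRadon {
  re_plus : {measure set (euc R d) -> \bar R} ;
  re_minus : {measure set (euc R d) -> \bar R} ;
  im_plus : {measure set (euc R d) -> \bar R} ;
  im_minus : {measure set (euc R d) -> \bar R} ;
  re_plus_radon : positive_radon re_plus ;
  re_minus_radon : positive_radon re_minus ;
  im_plus_radon : positive_radon im_plus ;
  im_minus_radon : positive_radon im_minus ;
  re_singular : singular_on_orthant re_plus re_minus ;
  im_singular : singular_on_orthant im_plus im_minus }.

Implicit Types mu : complex_radon.

(** The value mu(E), meaningful when |mu|(E) < oo: by singularity each of the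
    four components is bounded by |mu|, so no infinite value is truncated by
    [fine]. *)
Definition cmeas mu (E : set (euc R d)) : R[i] :=
  (fine (re_plus mu E) - fine (re_minus mu E)) +i*
  (fine (im_plus mu E) - fine (im_minus mu E)).

(** |mu|(E), as the supremum of sum_i |mu(E_i)| over finite families of
    disjoint relatively compact Borel subsets E_i of E; it does not see the
    part of E outside (0, oo)^d. *)
Definition total_variation mu (E : set (euc R d)) : \bar R :=
  ereal_sup [set v | exists n (F : 'I_n -> set (euc R d)),
    [/\ trivIset setT F,
        forall i, [/\ measurable (F i), relcompact (F i) & F i `<=` E] &
        v = (\sum_(i < n) cabs (cmeas mu (F i)))%:E] ].

End radon.
Arguments complex_radon : clear implicits.

Section potentials.
Context {R : realType} {d : nat}.
Implicit Types (g : euc R d -> R[i]) (mu : complex_radon R d) (r : euc R d).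

Definition cmeasurable (D : set (euc R d)) g :=
  measurable_fun D (fun x => complex.Re (g x)) /\
  measurable_fun D (fun x => complex.Im (g x)).

(** [majorant mu r] is M_g(r) when mu = mu_g. *)
Definition majorant mu r : \bar R :=
  (\int[total_variation mu]_(t in orthant)
     (\prod_(k < d) Num.min (ecoord r k) (ecoord t k))%:E)%E.

(** [g : euc R d -> R[i]] stands for a function on (0, oo)^d: its values
    elsewhere are irrelevant. *)
Definition upper_tail_potential g mu :=
  [/\ cmeasurable orthant g,
      {ae lebesgue d, forall x, orthant x -> g x = cmeas mu (Qstar x)} &
      forall r, orthant r -> (majorant mu r < +oo)%E].

Definition canonical_version g mu :=
  forall x, orthant x -> g x = cmeas mu (Qstar x).

Definition RMGM (K : R) (lambda : euc R d) g :=
  exists mu, [/\ upper_tail_potential g mu, canonical_version g mu &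
    forall r, orthant r ->
      (majorant mu r <=
       K%:E * \int[lebesgue d]_(x in Qbox (evec (fun k => ecoord lambda k * ecoord r k)%R))
                (cabs (g x))%:E)%E].

Definition even_extension g (f : euc R d -> R[i]) :=
  cmeasurable setT f /\
  forall x, \prod_(k < d) ecoord x k != 0 ->
    f x = g (evec (fun k => `|ecoord x k|)).

End potentials.

Section fourier.
Context {R : realType} {d : nat}.
Implicit Types (f : euc R d -> R[i]) (x xi eps : euc R d).

Definition cintegral f : R[i] :=
  Rintegral (lebesgue d) setT (fun x => complex.Re (f x)) +i*
  Rintegral (lebesgue d) setT (fun x => complex.Im (f x)).

(** exp(i x.xi) *)
Definition expi x xi : R[i] :=
  let t := \sum_(k < d) ecoord x k * ecoord xi k in cos t +i* sin t.

Definition fourier f xi : R[i] := cintegral (fun x => f x * expi x xi).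

Definition fourier_eps f eps xi : R[i] :=
  cintegral (fun x =>
    f x * (expR (- \sum_(k < d) ecoord eps k * `|ecoord x k|))%:C
        * expi x xi).

(** The filter of eps -> 0+ in (0, oo)^d, all coordinates tending to 0 at
    arbitrary relative rates. *)
Definition at_0plus : set_system (euc R d) :=
  filter_from [set delta : R | 0 < delta]
    (fun delta => [set eps | forall k, 0 < ecoord eps k < delta]).

Definition abel_fourier f xi : R[i] :=
  if \prod_(k < d) ecoord xi k == 0 then 0
  else lim ((fourier_eps f eps xi : (R[i] : numFieldType)) @[eps --> at_0plus]).

Definition integrable_L1 f :=
  cmeasurable setT f /\ (\int[lebesgue d]_x (cabs (f x))%:E < +oo)%E.

End fourier.

Definition weight {R : realType} {d} (rho x : euc R d) : R :=
  if \prod_(k < d) ecoord x k == 0 then 0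
  else \prod_(k < d) `|ecoord x k| `^ ecoord rho k.

Definition weighted {R : realType} {d} (rho : euc R d)
    (f : euc R d -> R[i]) : euc R d -> R[i] :=
  fun x => (weight rho x)%:C * f x.

(** Each step takes the norm in the current first variable, so x_1 is
    innermost and x_d outermost. *)
Fixpoint mixed_norm_rec {R : realType} {d} :
    euc R d -> (euc R d -> \bar R) -> \bar R :=
  match d with
  | 0 => fun _ F => F [tuple]
  | d'.+1 => fun s F =>
      mixed_norm_rec (behead_tuple s : euc R d')
        (fun y => Lnorm lebesgue_measure (thead s : R)%:E
                    (fun x : measurableTypeR R => F (cons_tuple x y)))
  end.

Definition mixed_norm {R : realType} {d} (s : euc R d)
    (F : euc R d -> R[i]) : \bar R :=
  mixed_norm_rec s (fun x => (cabs (F x))%:E).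

Definition in_mixed_L {R : realType} {d} (s : euc R d)
    (F : euc R d -> R[i]) :=
  cmeasurable setT F /\ (mixed_norm s F < +oo)%E.

(* Main.v *)
Require Import Defs.
From HB Require Import structures.
From mathcomp Require Import all_boot all_order all_algebra.
From mathcomp Require Import complex.
From mathcomp Require Import all_classical all_reals all_analysis.
From mathcomp Require Import measurable_realfun.
From mathcomp Require Import ring lra.

Set Implicit Arguments.
Unset Strict Implicit.
Unset Printing Implicit Defensive.

Import Order.TTheory GRing.Theory Num.Theory.
Import numFieldNormedType.Exports.

Local Open Scope classical_set_scope.
Local Open Scope ring_scope.

(** The Fourier transform of an even upper-tail potential is controlled by its
    majorant, and the RMGM condition turns the majorant into an average of the
    potential over a box shrinking like 1/|xi|.  The theorem is then a weighted
    Hardy inequality in mixed norms.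

    Fourier side.  Write g(x) = mu(Q*(x)) and split mu into its four positive
    Jordan components nu.  For such a nu, the function nu(Q*(|x|)) is an average
    over t of indicators of symmetric boxes |x_k| <= t_k.  Multiplied by the
    damping exp(-eps_k |x_k|), each box has a Fourier transform that is a product
    of one-dimensional integrals, and each factor is at most
    8 min(t_k, 1/|xi_k|), uniformly in eps: it is bounded by the length of the
    interval and also by an explicit antiderivative.  By Fubini the damped
    transform of the tail is at most 8^d times the integral of
    prod_k min(t_k, 1/|xi_k|) against nu ([osc_tail_bound]).  Since nu is
    dominated by |mu| on the orthant ([component_le_majorant]), this is at most
    8^d M_g(1/|xi|).  The bound does not involve eps, so it survives the limit
    defining the Abel transform ([cabs_lim_at_0plus]) and, by dominated
    convergence when f is integrable, it holds for the ordinary transform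
    ([undamped_integral_le]).  Finally RMGM bounds M_g(1/|xi|) by K times the
    integral of |f| over the box prod_k (0, lambda_k/|xi_k|).

    Hardy side.  In one variable put gamma = alpha + 1/q > 0.  Jensen's
    inequality with the weight x^(gamma-1) moves the power p inside the integral
    over (0, lambda/|xi|), and Minkowski's integral inequality with exponent
    q/p >= 1 exchanges the remaining xi-norm with that integral; the power of x
    that comes out is exactly beta p ([hardy_average]).  In several variables the
    box integral is an iterated integral ([box_integral_cons]): Hardy's
    inequality in x_1 handles the innermost norm, Minkowski's integral inequality
    carries that norm through the integrals in the other variables, and induction
    on the dimension does the rest ([mixed_hardy]). *)

(** * Weighted Jensen inequality and Minkowski's integral inequality *)

Lemma powR1B {R : realType} (t p : R) : 0 < t -> t `^ (1 - p) = t / t `^ p.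
Proof. by move=> t0; rewrite powRB ?(gt_eqF t0) ?implybT// powRr1 ?ltW. Qed.

Section young_jensen.
Context {disp} {T : measurableType disp} {R : realType}.
Variable mu : {measure set T -> \bar R}.

(** An integral of a nonnegative function is a supremum over simple functions
    below it, so it is monotone even for functions not known to be measurable,
    such as those built from a Fourier transform. *)
Lemma le_integral_nonneg (f g : T -> \bar R) :
  (forall x, 0 <= f x)%E -> (forall x, f x <= g x)%E ->
  (\int[mu]_x f x <= \int[mu]_x g x)%E.
Proof.
move=> f0 fg; rewrite !ge0_integralTE//; last first.
  by move=> x; exact: le_trans (fg x).
apply: le_ereal_sup => _ [h /= hf <-]; exists h => //= x.
exact: le_trans (fg x).
Qed.

(** The convex function a |-> a^p lies above its tangent at t, here divided by
    p t^(p-1). *)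
Lemma young_tangent (p a t : R) : 1 <= p -> 0 <= a -> 0 < t ->
  a <= p^-1 * (a `^ p * t `^ (1 - p)) + (1 - p^-1) * t.
Proof.
move=> p1 a0 t0; have p0 : 0 < p by rewrite (lt_le_trans _ p1).
have [->|p1n] := eqVneq p 1.
  by rewrite subrr powRr0 powRr1// mulr1 invr1 mul1r subrr mul0r addr0.
have p_gt1 : 1 < p by rewrite lt_neqAle eq_sym p1n.
have q0 : 0 < (1 - p^-1)^-1 by rewrite invr_gt0 subr_gt0 invf_lt1.
have at0 : 0 <= a / t by rewrite divr_ge0// ltW.
have pq : p^-1 + (1 - p^-1)^-1^-1 = 1 by rewrite invrK addrC subrK.
have := conjugate_powR at0 ler01 p0 q0 pq.
rewrite mulr1 powR1 div1r invrK -(ler_pM2r t0) divfK ?gt_eqF//.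
move/le_trans; apply.
rewrite mulrDl lerD2r powRM ?invr_ge0 ?(ltW t0)//.
have -> : t `^ (1 - p) = t * (t^-1 `^ p).
  rewrite powR1B//; congr (_ * _).
  by rewrite -(powR_inv1 (ltW t0)) -powRrM mulN1r powRN.
by rewrite le_eqVlt; apply/orP; left; apply/eqP; ring.
Qed.

(** The same inequality with tangent point s t.  It still holds at infinite
    values, which lets the integral inequalities below treat densities that are
    infinite on null sets without discarding them. *)
Lemma young_tangent_ereal (p s : R) (a t : \bar R) : 1 <= p -> 0 < s ->
  (0 <= a)%E -> (0 < t)%E ->
  (a <= (p^-1 * s `^ (1 - p))%:E * (a `^ p * t `^ (1 - p))
        + ((1 - p^-1) * s)%:E * t)%E.
Proof.
move=> p1 s0 a0 t0; have p0 : 0 < p by rewrite (lt_le_trans _ p1).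
have c0 : 0 < p^-1 * s `^ (1 - p) by rewrite mulr_gt0 ?invr_gt0// powR_gt0.
have c1 : 0 <= (1 - p^-1) * s.
  by rewrite mulr_ge0 ?(ltW s0)// subr_ge0 invf_le1.
case: t t0 => [t t0|_|//]; last first.
  have [->|p1n] := eqVneq p 1.
    rewrite subrr powRr0 poweRe0 mule1 poweRe1// mulr1 invr1 mul1e.
    by rewrite subrr mul0r mul0e adde0.
  have c1' : 0 < (1 - p^-1) * s.
    by rewrite mulr_gt0// subr_gt0 invf_lt1// lt_neqAle eq_sym p1n.
  rewrite [((_ * s)%:E * _)%E]gt0_muley ?lte_fin// addey ?leey//.
  rewrite -ltNye; apply: (lt_le_trans (ltNyr 0)).
  by rewrite !mule_ge0 ?poweR_ge0// lee_fin ltW.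
rewrite lte_fin in t0.
case: a a0 => [a a0|_|//]; last first.
  rewrite poweRyr ?gt_eqF// gt0_mulye ?poweR_EFin ?lte_fin ?powR_gt0//.
  by rewrite gt0_muley ?lte_fin.
rewrite lee_fin in a0.
rewrite !poweR_EFin -!EFinM -EFinD lee_fin.
have st0 : 0 < s * t by rewrite mulr_gt0.
apply: (le_trans (young_tangent p1 a0 st0)).
rewrite powRM ?(ltW s0) ?(ltW t0)// le_eqVlt; apply/orP; left; apply/eqP; ring.
Qed.

(** Integrating the tangent inequality and then choosing the tangent point s
    optimally gives Jensen's inequality for the measure phi dmu applied to the
    function F / phi. *)
Lemma jensen_weighted (p A : R) (D : set T) (F phi : T -> \bar R) :
  measurable D -> 1 <= p -> 0 < A ->
  measurable_fun D F -> (forall x, D x -> 0 <= F x)%E ->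
  measurable_fun D phi -> (forall x, D x -> 0 < phi x)%E ->
  (\int[mu]_(x in D) phi x <= A%:E)%E ->
  ((\int[mu]_(x in D) F x) `^ p <=
   (A `^ (p - 1))%:E * \int[mu]_(x in D) (F x `^ p * phi x `^ (1 - p)))%E.
Proof.
move=> mD p1 A0 mF F0 mphi phi0 phiA.
have p0 : 0 < p by rewrite (lt_le_trans _ p1).
have mFp : measurable_fun D (fun x => F x `^ p * phi x `^ (1 - p))%E.
  apply: emeasurable_funM; apply: (measurableT_comp (measurable_poweR _)) => //.
have Fp0 x : D x -> (0 <= F x `^ p * phi x `^ (1 - p))%E.
  by move=> _; rewrite mule_ge0 ?poweR_ge0.
have I0 : (0 <= \int[mu]_(x in D) F x)%E by exact: integral_ge0.
have B0 : (0 <= \int[mu]_(x in D) (F x `^ p * phi x `^ (1 - p)))%E.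
  exact: integral_ge0.
have key s : 0 < s -> (\int[mu]_(x in D) F x <=
    (p^-1 * s `^ (1 - p))%:E * \int[mu]_(x in D) (F x `^ p * phi x `^ (1 - p))
    + ((1 - p^-1) * s * A)%:E)%E.
  move=> s0.
  have c0 : 0 <= p^-1 * s `^ (1 - p).
    by rewrite mulr_ge0 ?invr_ge0 ?powR_ge0// ltW.
  have c1 : 0 <= (1 - p^-1) * s.
    by rewrite mulr_ge0 ?(ltW s0)// subr_ge0 invf_le1.
  apply: (@le_trans _ _ (\int[mu]_(x in D)
    ((p^-1 * s `^ (1 - p))%:E * (F x `^ p * phi x `^ (1 - p))
     + ((1 - p^-1) * s)%:E * phi x))%E).
    apply: ge0_le_integral => //.
    - apply: emeasurable_funD; apply: emeasurable_funM => //;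
      exact: measurable_cst.
    - move=> x Dx; apply: young_tangent_ereal => //; [exact: F0|exact: phi0].
  rewrite ge0_integralD//; first last.
  - by apply: emeasurable_funM => //; exact: measurable_cst.
  - by move=> x Dx; rewrite mule_ge0 ?lee_fin// ltW// phi0.
  - by apply: emeasurable_funM => //; exact: measurable_cst.
  - by move=> x Dx; rewrite mule_ge0 ?lee_fin// Fp0.
  rewrite !ge0_integralZl//; first last.
  - by move=> x Dx; rewrite ltW// phi0.
  by apply: leeD2l; rewrite [leRHS]EFinM lee_wpmul2l ?lee_fin.
move: B0 key; case: (\int[mu]_(x in D) (F x `^ p * phi x `^ (1 - p)))%E => //;
  last by move=> _ _; rewrite gt0_muley ?leey// lte_fin powR_gt0.
move=> b; rewrite lee_fin => b0 key.
move: I0 key; case: (\int[mu]_(x in D) F x)%E => // [i|]; last first.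
  by move=> _ /(_ 1 ltr01); rewrite leye_eq.
rewrite lee_fin => i0 key; rewrite poweR_EFin lee_fin.
(* b may vanish, in which case no s is optimal: perturb it to b' > b. *)
suff key2 b' : b < b' -> i `^ p <= A `^ (p - 1) * b'.
  apply/ler_addgt0Pr => e e0.
  have Ap0 : 0 < A `^ (p - 1) by rewrite powR_gt0.
  rewrite -[X in _ + X](mulfVK (lt0r_neq0 Ap0)) [X in _ + X]mulrC -mulrDr.
  by apply: key2; rewrite ltrDl divr_gt0.
move=> bb'; have b'0 : 0 < b' by exact: le_lt_trans bb'.
pose s := (b' / A) `^ p^-1.
have s0 : 0 < s by rewrite powR_gt0// divr_gt0.
have sp : s `^ p = b' / A.
  by rewrite -powRrM mulVf ?gt_eqF// powRr1// ltW// divr_gt0.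
have i_le : i <= s * A.
  move: (key s s0); rewrite -EFinM -EFinD lee_fin => /le_trans; apply.
  rewrite powR1B// sp.
  rewrite (_ : s * A = p^-1 * (s / (b' / A)) * b' + (1 - p^-1) * s * A).
    rewrite lerD2r ler_wpM2l ?(ltW bb')//.
    by rewrite mulr_ge0 ?invr_ge0 ?(ltW p0)// divr_ge0 ?ltW// divr_gt0.
  by field; rewrite ?gt_eqF.
apply: (@le_trans _ _ ((s * A) `^ p)).
  rewrite ge0_ler_powR ?nnegrE ?(ltW p0)//.
  by rewrite mulr_ge0 ?ltW.
rewrite powRM ?(ltW s0) ?(ltW A0)// sp.
rewrite powRB ?(gt_eqF A0) ?implybT// powRr1 ?(ltW A0)//.
by rewrite le_eqVlt; apply/orP; left; apply/eqP; field; rewrite gt_eqF.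
Qed.

End young_jensen.

(** Used to perturb a nonnegative function into a positive one at an arbitrarily
    small cost in the integral. *)
Lemma sigma_finite_integrable_gt0 {disp} {T : measurableType disp}
    {R : realType} (m : {sigma_finite_measure set T -> \bar R}) :
  exists psi : T -> \bar R, [/\ measurable_fun setT psi,
    (forall x, 0 < psi x)%E & (\int[m]_x psi x <= 1)%E].
Proof.
have [F TF Foo] := sigma_finiteT m.
pose c n : R := 2^-1 ^+ n.+1 / (1 + fine (m (F n))).
have c0 n : 0 < c n.
  rewrite divr_gt0 ?exprn_gt0 ?invr_gt0//.
  by rewrite ltr_wpDr// fine_ge0.
have mF n : measurable (F n) by have [] := Foo n.
pose u n x := ((c n)%:E * (\1_(F n) x)%:E)%E.
have u0 n x : (0 <= u n x)%E.
  by rewrite mule_ge0 ?lee_fin// ltW.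
have mu_ n : measurable_fun setT (u n).
  apply: emeasurable_funM; first exact: measurable_cst.
  by apply/measurable_EFinP; exact: measurable_indic.
exists (fun x => \sum_(n <oo) u n x)%E; split.
- by apply: ge0_emeasurable_sum => // n x _ _; exact: u0.
- move=> x; have [n _ Fnx] : (\bigcup_n F n) x by rewrite -TF.
  apply: (@lt_le_trans _ _ (u n x)).
    rewrite /u indicE mem_set// mule1 lte_fin; exact: c0.
  by rewrite (@nneseriesD1 _ _ n)// leeDl// nneseries_ge0.
- rewrite integral_nneseries//.
  apply: (@le_trans _ _ (\sum_(n <oo) (1 / (2 ^ n.+1)%:R)%:E)%E).
    apply: lee_nneseries => [n _ _|n _].
      by apply: integral_ge0 => x _; exact: u0.
    rewrite ge0_integralZl//; last by rewrite lee_fin ltW.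
      rewrite integral_indic// setIT.
      have [_ Fnoo] := Foo n.
      rewrite [X in (_ * X)%E](_ : _ = (fine (m (F n)))%:E); last first.
        by rewrite fineK// ge0_fin_numE.
      rewrite -EFinM lee_fin.
      rewrite /c -mulrA natrX exprVn div1r ler_piMr ?invr_ge0 ?exprn_ge0//.
      rewrite ler_pdivrMl ?mulr1 ?ler_wpDl//.
      by rewrite ltr_wpDr// fine_ge0.
    by apply/measurable_EFinP; exact: measurable_indic.
  exact: (@epsilon_trick0 R 1 xpredT ler01).
Qed.

Section minkowski_integral.
Context {d1 d2 : measure_display} {T1 : measurableType d1}
  {T2 : measurableType d2} {R : realType}.
Variables (m1 : {sigma_finite_measure set T1 -> \bar R})
  (m2 : {sigma_finite_measure set T2 -> \bar R}).

Lemma measurable_Lnorm_section (p : R) (F : T1 * T2 -> \bar R) :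
  measurable_fun setT F -> (forall z, 0 <= F z)%E ->
  measurable_fun setT (fun y => Lnorm m1 p%:E (fun x => F (x, y))).
Proof.
move=> mF F0; rewrite unlock.
apply: (measurableT_comp (measurable_poweR _)).
apply: (measurable_fun_fubini_tonelli_G (fun z => `|F z| `^ p)%E).
  apply: (measurableT_comp (measurable_poweR _)).
  exact: measurableT_comp.
by move=> z; exact: poweR_ge0.
Qed.

(** Apply [jensen_weighted] in y with the weight phi(y), the norm of F(., y), and
    integrate in x: by Tonelli the right-hand side becomes the integral of phi,
    to the power p.  The norms phi(y) may vanish, hence the weight phi + e psi
    with psi > 0 integrable, and e tending to 0. *)
Lemma minkowski_integral (p : R) (F : T1 * T2 -> \bar R) : 1 <= p ->
  measurable_fun setT F -> (forall z, 0 <= F z)%E ->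
  (Lnorm m1 p%:E (fun x => \int[m2]_y F (x, y)) <=
   \int[m2]_y Lnorm m1 p%:E (fun x => F (x, y)))%E.
Proof.
move=> p1 mF F0; have p0 : 0 < p by rewrite (lt_le_trans _ p1).
pose phi y := Lnorm m1 p%:E (fun x => F (x, y)).
have phi0 y : (0 <= phi y)%E by exact: Lnorm_ge0.
have mphi : measurable_fun setT phi by exact: measurable_Lnorm_section.
rewrite -/phi.
have : (0 <= \int[m2]_y phi y)%E by exact: integral_ge0.
case E : (\int[m2]_y phi y)%E => [Phi| |//]; last by move=> _; rewrite leey.
rewrite lee_fin => Phi0.
have [psi [mpsi psi0 psi1]] := sigma_finite_integrable_gt0 m2.
apply/lee_addgt0Pr => e e0.
pose phie y := (phi y + e%:E * psi y)%E.
have mphie : measurable_fun setT phie.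
  apply: emeasurable_funD => //.
  by apply: emeasurable_funM => //; exact: measurable_cst.
have phie0 y : (0 < phie y)%E.
  apply: (@lt_le_trans _ _ (e%:E * psi y)%E).
    by rewrite mule_gt0 ?lte_fin.
  by rewrite leeDr.
have A0 : 0 < Phi + e by rewrite ltr_wpDl.
have phiA : (\int[m2]_y phie y <= (Phi + e)%:E)%E.
  rewrite ge0_integralD//; last 2 first.
  - by move=> y _; rewrite mule_ge0 ?lee_fin ?(ltW e0)// ltW.
  - by apply: emeasurable_funM => //; exact: measurable_cst.
  rewrite E EFinD leeD2l// ge0_integralZl//; last 2 first.
  - by move=> y _; exact: ltW.
  - by rewrite lee_fin ltW.
  by rewrite -[leRHS]mule1 lee_wpmul2l// lee_fin ltW.
pose G z := (F z `^ p * phie z.2 `^ (1 - p))%E.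
have mG : measurable_fun setT G.
  apply: emeasurable_funM; apply: (measurableT_comp (measurable_poweR _)) => //.
  by apply: measurableT_comp => //; exact: measurable_snd.
have G0 z : (0 <= G z)%E by rewrite mule_ge0 ?poweR_ge0.
have le_phie y : (\int[m1]_x G (x, y) <= phie y)%E.
  rewrite /G/= ge0_integralZr//; last 3 first.
  - apply: (measurableT_comp (measurable_poweR _)).
    by apply: (measurableT_comp mF); exact: measurable_pair2.
  - by move=> x _; exact: poweR_ge0.
  - exact: poweR_ge0.
  have -> : (\int[m1]_x F (x, y) `^ p = phi y `^ p)%E.
    rewrite /phi poweR_Lnorm ?gt_eqF//.
    by apply: eq_integral => x _; rewrite gee0_abs.
  have /le_trans : (phi y `^ p * phie y `^ (1 - p) <=
                    phie y `^ p * phie y `^ (1 - p))%E.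
    rewrite lee_wpmul2r ?poweR_ge0// gt0_ler_poweR ?(ltW p0)//.
    - by rewrite in_itv/= phi0 leey.
    - by rewrite in_itv/= (ltW (phie0 y)) leey.
    - by rewrite /phie leeDl// mule_ge0 ?ltW// psi0.
  apply; move: (phie0 y); case: (phie y) => [r|_|//]; last by rewrite leey.
  rewrite lte_fin => r0; rewrite !poweR_EFin -EFinM lee_fin powR1B//.
  by rewrite mulrCA mulfV ?mulr1// gt_eqF// powR_gt0.
have {}le_phie : (\int[m1]_x \int[m2]_y G (x, y) <= (Phi + e)%:E)%E.
  rewrite fubini_tonelli//; apply: le_trans phiA.
  apply: ge0_le_integral => //; first by move=> y _; exact: integral_ge0.
  exact: measurable_fun_fubini_tonelli_G.
have mI : measurable_fun setT (fun x => \int[m2]_y F (x, y))%E.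
  exact: measurable_fun_fubini_tonelli_F.
have key : (\int[m1]_x ((\int[m2]_y F (x, y)) `^ p) <= ((Phi + e) `^ p)%:E)%E.
  apply: (@le_trans _ _ (\int[m1]_x (((Phi + e) `^ (p - 1))%:E *
      \int[m2]_y G (x, y)))%E).
    apply: le_integral_nonneg => x; first exact: poweR_ge0.
    apply: jensen_weighted => //.
    by apply: (measurableT_comp mF); exact: measurable_pair1.
  rewrite ge0_integralZl//; last 3 first.
  - exact: measurable_fun_fubini_tonelli_F.
  - by move=> x _; exact: integral_ge0.
  - by rewrite lee_fin powR_ge0.
  apply: (@le_trans _ _ (((Phi + e) `^ (p - 1))%:E * (Phi + e)%:E)%E).
    by rewrite lee_wpmul2l// lee_fin powR_ge0.
  by rewrite -EFinM lee_fin mulrC mulr_powRB1// ltW.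
rewrite unlock.
under eq_integral => x _ do rewrite gee0_abs ?integral_ge0//.
rewrite -EFinD -[leRHS]poweRe1 ?lee_fin ?(ltW A0)// -(mulfV (lt0r_neq0 p0)).
rewrite poweRrM gt0_ler_poweR ?invr_ge0 ?(ltW p0)// ?in_itv/= ?leey ?andbT//.
- by apply: integral_ge0 => x _; exact: poweR_ge0.
- by rewrite lee_fin powR_ge0.
Qed.

End minkowski_integral.

(** * Hardy's inequality in one variable *)

Section power_integrals.
Context {R : realType}.
Local Notation mu := (@lebesgue_measure R).

Lemma FTC2_is_derive (f F : R -> R) (a b : R) : a < b ->
  (forall x, x \in `[a, b] -> is_derive x 1 F (f x)) ->
  (forall x, x \in `[a, b] -> {for x, continuous f}) ->
  (\int[mu]_(x in `[a, b]) (f x)%:E = (F b - F a)%:E)%E.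
Proof.
move=> ab dF cf; rewrite (continuous_FTC2 (F := F))//.
- apply: continuous_in_subspaceT => x; rewrite inE/=; exact: cf.
- have cF x : x \in `[a, b] -> {for x, continuous F}.
    move=> xab; apply: differentiable_continuous.
    by apply/derivable1_diffP; have [] := dF x xab.
  split.
  + move=> x xab; have [] // := dF x; exact: subset_itv_oo_cc xab.
  + by apply: cvg_at_right_filter; apply: cF; rewrite in_itv/= lexx ltW.
  + by apply: cvg_at_left_filter; apply: cF; rewrite in_itv/= lexx ltW.
- move=> x xab; rewrite derive1E; have [|_ ->//] := dF x.
  exact: subset_itv_oo_cc xab.
Qed.

(** For c < 1 the integrand is unbounded at 0, so the fundamental theorem is
    applied on [1/(n+1), r] and n tends to infinity. *)
Lemma integral_powR_le (c r : R) : 0 < c ->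
  (\int[mu]_(x in `]0%R, r[) (x `^ (c - 1))%:E <= (r `^ c / c)%:E)%E.
Proof.
move=> c0; have [r0|r0] := leP r 0.
  by rewrite set_itv_ge ?integral_set0 ?lee_fin ?divr_ge0 ?powR_ge0 ?ltW//
    bnd_simp -leNgt.
have mf (D : set R) : measurable_fun D (fun x : R => (x `^ (c - 1))%:E).
  by apply/measurable_EFinP; apply: measurable_funS (measurable_powR _).
pose E n : set R := `[n.+1%:R^-1, r[%classic.
have mE n : measurable (E n) by exact: measurable_itv.
have -> : `]0%R, r[%classic = \bigcup_n E n.
  apply/seteqP; split => x /=; rewrite ?in_itv/=.
    move=> /andP[x0 xr]; exists (Num.truncn x^-1) => //; rewrite /E/= in_itv/= xr andbT.
    rewrite -[leRHS]invrK lef_pV2 ?posrE ?invr_gt0//.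
    by apply: ltW; rewrite truncnS_gt.
  move=> [n _]; rewrite /E/= in_itv/= => /andP[nx ->]; rewrite andbT.
  by apply: lt_le_trans nx.
have := @ge0_nondecreasing_set_cvg_integral _ (measurableTypeR R) R E
  (fun x => (x `^ (c - 1))%:E) mu.
move=> /(_ _ mE _ _)/wrap[].
- apply/nondecreasing_seqP => n; apply/subsetPset => x; rewrite /E/= !in_itv/=.
  move=> /andP[nx ->]; rewrite andbT (le_trans _ nx)// lef_pV2 ?posrE//.
  by rewrite ler_nat.
- by move=> n; exact: mf.
- by move=> n x _; rewrite lee_fin powR_ge0.
move=> Elim; rewrite -(cvg_lim _ Elim)//.
apply: lime_le; first by apply/cvg_ex; eexists; exact: Elim.
apply: nearW => n.
have [nr|rn] := ltP n.+1%:R^-1 r; last first.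
  rewrite /E set_itv_ge ?integral_set0 ?lee_fin ?divr_ge0 ?powR_ge0 ?ltW//.
  by rewrite bnd_simp -leNgt.
have le1 : (\int[mu]_(x in E n) (x `^ (c - 1))%:E <=
    \int[mu]_(x in `[(n.+1%:R^-1)%R, r]) (x `^ (c - 1))%:E)%E.
  apply: ge0_subset_integral => //.
  - exact: mE.
  - exact: mf.
  - by move=> x _; rewrite lee_fin powR_ge0.
  - by apply: subset_itvl; rewrite bnd_simp.
apply: (le_trans le1).
have pos (x : R) : x \in `[n.+1%:R^-1, r] -> 0 < x.
  by rewrite in_itv/= => /andP[nx _]; exact: lt_le_trans nx.
have dF x : x \in `[n.+1%:R^-1, r] ->
    is_derive x 1 (fun x => c^-1 * x `^ c) (x `^ (c - 1)).
  move=> /pos x0; have dp := is_derive1_powR c x0.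
  apply: (is_derive_eq (is_deriveZ c^-1 dp)).
  by rewrite /GRing.scale/= mulKf ?gt_eqF.
rewrite (FTC2_is_derive nr dF).
  rewrite lee_fin [r `^ c / c]mulrC gerBl mulr_ge0 ?invr_ge0 ?powR_ge0//.
  exact: ltW.
move=> x /pos x0; apply: differentiable_continuous; apply/derivable1_diffP.
by apply: derivable_powR; rewrite in_itv/= x0.
Qed.

Lemma ge0_integralN (f : R -> \bar R) :
  measurable_fun setT f -> (forall x, 0 <= f x)%E ->
  (\int[mu]_x f (- x)%R = \int[mu]_x f x)%E.
Proof.
move=> mf f0; rewrite [RHS](@eq_measure_integral _ _ _ _
    (pushforward mu (-%R : _ -> measurableTypeR R))); last first.
  by move=> A mA _; exact/esym/lebesgue_measureN.
by rewrite ge0_integral_pushforward//= preimage_setT.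
Qed.

(** The one-dimensional factor of [weight], which vanishes at 0. *)
Definition pweight (a x : R) : R := if x == 0 then 0 else `|x| `^ a.

Lemma pweight_ge0 a x : 0 <= pweight a x.
Proof. by rewrite /pweight; case: ifPn => // _; rewrite powR_ge0. Qed.

Lemma measurable_pweight a : measurable_fun setT (pweight a).
Proof.
apply: measurable_fun_ifT => //.
- by apply: measurable_fun_eqr.
- by apply: (measurableT_comp (measurable_powR _)); exact: normr_measurable.
Qed.

Lemma integral_pweight_le (c r : R) : 0 < c ->
  (\int[mu]_x (if `|x : R| < r then pweight (c - 1) x else 0)%R%:E
     <= (2 * (r `^ c / c))%:E)%E.
Proof.
move=> c0.
pose H (x : R) := (x `^ (c - 1) * \1_(`]0, r[%classic) x)%:E.
have mH : measurable_fun setT H.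
  apply/measurable_EFinP; apply: measurable_funM; first exact: measurable_powR.
  exact: measurable_indic.
have H0 x : (0 <= H x)%E by rewrite lee_fin mulr_ge0 ?powR_ge0.
have HE : (\int[mu]_x H x <= (r `^ c / c)%:E)%E.
  apply: le_trans (integral_powR_le r c0).
  rewrite [leRHS]integral_mkcond le_eqVlt; apply/orP; left; apply/eqP.
  apply: eq_integral => x _; rewrite /H patchE indicE.
  by case: ifPn => xr; rewrite ?mulr1 ?mulr0.
apply: (@le_trans _ _ (\int[mu]_x (H x + H (- x)%R))%E).
  apply: le_integral_nonneg => x.
    by rewrite lee_fin; case: ifPn => // _; rewrite pweight_ge0.
  rewrite -EFinD lee_fin; have [xr|xr] := ltP `|x : R| r; last first.
    by rewrite addr_ge0// mulr_ge0 ?powR_ge0.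
  rewrite /pweight; have [->|x0] := eqVneq (x : R) 0.
    by rewrite addr_ge0// mulr_ge0 ?powR_ge0.
  have [x_gt0|x_lt0] := ltP (0 : R) x.
    rewrite gtr0_norm// in xr *.
    rewrite indicE mem_set/= ?in_itv/= ?x_gt0// mulr1.
    by rewrite lerDl mulr_ge0 ?powR_ge0.
  have {}x_lt0 : x < 0 by rewrite lt_neqAle x0.
  rewrite ltr0_norm// in xr *.
  rewrite [X in _ + _ * X]indicE mem_set/= ?in_itv/= ?oppr_gt0 ?x_lt0// mulr1.
  by rewrite lerDr mulr_ge0 ?powR_ge0.
rewrite ge0_integralD//; last first.
  by apply: (measurableT_comp mH); exact: oppr_measurable.
rewrite ge0_integralN// mulrDl mul1r EFinD leeD//.
Qed.

End power_integrals.

Lemma le_poweR {R : realType} (r : R) (a b : \bar R) :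
  0 <= r -> (0 <= a)%E -> (a <= b)%E -> (a `^ r <= b `^ r)%E.
Proof.
move=> r0 a0 ab; apply: gt0_ler_poweR => //; rewrite in_itv/= leey andbT//.
exact: le_trans ab.
Qed.

Lemma ge0_LnormE {disp} {T : measurableType disp} {R : realType}
    (mu : {measure set T -> \bar R}) (r : R) (f : T -> \bar R) :
  (forall x, 0 <= f x)%E ->
  Lnorm mu r%:E f = ((\int[mu]_x (f x `^ r)) `^ r^-1)%E.
Proof.
move=> f0; rewrite unlock; congr (_ `^ _)%E.
by apply: eq_integral => x _; rewrite gee0_abs.
Qed.

(** Here s is the exponent of Minkowski's inequality, k(xi) collects the powers
    of |xi|, v(x) is what [jensen_weighted] leaves of u^p, and F(xi, x) is their
    product restricted to x < lam/|xi|. *)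
Section hardy.
Context {R : realType}.
Local Notation mu := (@lebesgue_measure R).
Variables p q a lam : R.
Hypotheses (p1 : 1 <= p) (pq : p <= q) (qa : - q^-1 < a) (lam0 : 0 < lam).

Let g := a + q^-1.
Let s := q / p.
Let c0 := (lam `^ g / g) `^ (p - 1).
Let b := 1 - p^-1 - q^-1 - a.
Let c1 := c0 * ((2 / (g * s)) `^ s^-1 * lam `^ g).

Let p0 : 0 < p. Proof. exact: lt_le_trans p1. Qed.
Let q0 : 0 < q. Proof. exact: lt_le_trans pq. Qed.
Let g0 : 0 < g. Proof. by rewrite /g -ltrBlDr sub0r. Qed.
Let s0 : 0 < s. Proof. by rewrite divr_gt0. Qed.
Let s1 : 1 <= s. Proof. by rewrite ler_pdivlMr// mul1r. Qed.
Let c00 : 0 <= c0. Proof. exact: powR_ge0. Qed.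

Variable u : measurableTypeR R -> \bar R.
Hypotheses (mu_ : measurable_fun setT u) (u0 : forall x, (0 <= u x)%E).

Let v (x : measurableTypeR R) : \bar R := (u x `^ p * ((x `^ (g - 1)) `^ (1 - p))%:E)%E.
Let k (x : measurableTypeR R) : R := c0 * pweight (g - s^-1) x.
Let F (z : measurableTypeR R * measurableTypeR R) : \bar R :=
  if (0 < (z.2 : R)) && (`|z.1 : R| * z.2 < lam) then ((k z.1)%:E * v z.2)%E
  else 0%E.

Let v0 x : (0 <= v x)%E.
Proof. by rewrite mule_ge0 ?poweR_ge0// lee_fin powR_ge0. Qed.

Let k0 x : 0 <= k x. Proof. by rewrite mulr_ge0 ?pweight_ge0. Qed.

Let F0 z : (0 <= F z)%E.
Proof. by rewrite /F; case: ifPn => // _; rewrite mule_ge0// lee_fin. Qed.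

Let mv : measurable_fun setT v.
Proof.
apply: emeasurable_funM.
  exact: (measurableT_comp (measurable_poweR _)).
apply/measurable_EFinP; apply: (measurableT_comp (measurable_powR _)).
exact: measurable_powR.
Qed.

Let mF : measurable_fun setT F.
Proof.
apply: measurable_fun_ifT => //.
- apply: measurable_and; apply: measurable_fun_ltr => //.
  apply: measurable_funM => //.
  by apply: (measurableT_comp (@normr_measurable _ _)).
- apply: emeasurable_funM.
    apply/measurable_EFinP; apply: measurable_funM => //.
    by apply: (measurableT_comp (measurable_pweight _)).
  exact: measurableT_comp.
Qed.

(** Jensen's inequality on (0, lam/|xi|) with weight x^(g-1), whose integral is
    (lam/|xi|)^g / g. *)
Let pointwise (xi : measurableTypeR R) :
  (((pweight a xi)%:E * \int[mu]_(x in `](0%R : R), (lam / `|xi : R|)%R[) u x) `^ q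
   <= (\int[mu]_x F (xi, x)) `^ s)%E.
Proof.
have [xi0|xi0] := eqVneq (xi : R) 0.
  by rewrite {1}/pweight xi0 eqxx mul0e poweR0r ?gt_eqF// poweR_ge0.
set t := `|xi : R|; have t0 : 0 < t by rewrite normr_gt0.
set r := lam / t; have r0 : 0 < r by rewrite divr_gt0.
pose I : set (measurableTypeR R) := `]0, r[%classic.
have mI : measurable I by exact: measurable_itv.
rewrite -/I.
have -> : (\int[mu]_x F (xi, x) = (k xi)%:E * \int[mu]_(x in I) v x)%E.
  rewrite -ge0_integralZl//; last 2 first.
  - exact: measurable_funTS.
  - by rewrite lee_fin.
  rewrite [RHS]integral_mkcond; apply: eq_integral => x _.
  rewrite patchE /F/= -/t mulrC -ltr_pdivlMr// -/r.
  by rewrite mem_setE in_itv.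
have -> : q = p * s by rewrite /s mulrCA mulfV ?mulr1// gt_eqF.
rewrite poweRrM; apply: le_poweR; rewrite ?poweR_ge0 ?(ltW s0)//.
rewrite poweRM//; last 2 first.
- by rewrite lee_fin pweight_ge0.
- by apply: integral_ge0.
have A0 : 0 < r `^ g / g by rewrite divr_gt0// powR_gt0.
have J := @jensen_weighted _ _ R mu p (r `^ g / g) I u
  (fun x : R => (x `^ (g - 1))%:E) mI p1 A0 _ _ _ _ (integral_powR_le r g0).
have {}J : ((\int[mu]_(x in I) u x) `^ p <=
            ((r `^ g / g) `^ (p - 1))%:E * \int[mu]_(x in I) v x)%E.
  apply: J => //.
  - exact: measurable_funTS.
  - apply/measurable_EFinP.
    by apply: measurable_funS (measurable_powR _).
  - move=> x; rewrite /I/= in_itv/= => /andP[x0 _].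
    by rewrite lte_fin powR_gt0.
apply: (@le_trans _ _ ((pweight a xi)%:E `^ p *
  (((r `^ g / g) `^ (p - 1))%:E * \int[mu]_(x in I) v x))%E).
  by apply: lee_wpmul2l => //; rewrite poweR_ge0.
rewrite muleA poweR_EFin -EFinM; apply: lee_wpmul2r.
  by apply: integral_ge0.
rewrite lee_fin /k /pweight (negbTE xi0) -/t /c0 le_eqVlt; apply/orP; left.
apply/eqP; rewrite /r [(lam / t) `^ g]powRM ?invr_ge0 ?(ltW lam0) ?(ltW t0)//.
rewrite mulrAC [X in _ * X]powRM ?powR_ge0 ?divr_ge0 ?powR_ge0 ?(ltW g0)//.
rewrite mulrCA; congr (_ * _).
rewrite -(powR_inv1 (ltW t0)) -!powRrM -powRD; last first.
  by rewrite (gt_eqF t0) implybT.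
by congr (_ `^ _); rewrite /g /s; field; rewrite ?gt_eqF.
Qed.

(** For fixed x the constraint x < lam/|xi| reads |xi| < lam/x, and on that
    interval k^s is a multiple of |xi|^(g s - 1).  Its integral is a multiple of
    x^(- g s), which completes the powers of x in v to those of the weight. *)
Let section_bound (x : measurableTypeR R) :
  (Lnorm mu s%:E (fun xi => F (xi, x)) <=
   c1%:E * ((pweight b x)%:E * u x) `^ p)%E.
Proof.
have c10 : 0 <= c1 by rewrite mulr_ge0// mulr_ge0 ?powR_ge0.
rewrite ge0_LnormE//; have [x0|x0] := leP (x : R) 0.
  rewrite (_ : (\int[mu]_xi _)%E = 0%E); last first.
    apply: integral0_eq => xi _; rewrite /F/= ltNge x0/=.
    by rewrite powR0// gt_eqF.
  by rewrite poweR0r ?invr_eq0 ?gt_eqF// mule_ge0 ?poweR_ge0// lee_fin.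
have gs0 : 0 < g * s by rewrite mulr_gt0.
set h := fun xi : R =>
  (if `|xi| < lam / x then pweight (g * s - 1) xi else 0)%R%:E.
have mh : measurable_fun setT h.
  apply/measurable_EFinP; apply: measurable_fun_ifT => //.
    by apply: measurable_fun_ltr => //; exact: normr_measurable.
  exact: measurable_pweight.
have h0 xi : (0 <= h xi)%E.
  by rewrite lee_fin; case: ifPn => // _; rewrite pweight_ge0.
have -> : (\int[mu]_xi F (xi, x) `^ s =
           (c0 `^ s)%:E * v x `^ s * \int[mu]_xi h xi)%E.
  rewrite -ge0_integralZl//; last first.
    by rewrite mule_ge0 ?poweR_ge0// lee_fin powR_ge0.
  apply: eq_integral => xi _; rewrite /F/= x0/= -ltr_pdivlMr// /h.
  case: ifPn => _; last by rewrite poweR0r ?gt_eqF// mule0.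
  rewrite poweRM ?lee_fin// poweR_EFin muleAC -EFinM; congr (_%:E * _)%E.
  rewrite /k powRM ?pweight_ge0//; congr (_ * _).
  rewrite /pweight; case: ifPn => [_|xi0]; first by rewrite powR0// gt_eqF.
  by rewrite -powRrM mulrBl mulVf// gt_eqF.
have hle := integral_pweight_le (lam / x) gs0.
have I0 : 0 <= 2 * ((lam / x) `^ (g * s) / (g * s)).
  by rewrite mulr_ge0// divr_ge0 ?powR_ge0// ltW.
apply: (@le_trans _ _ (((c0 `^ s)%:E * v x `^ s *
    (2 * ((lam / x) `^ (g * s) / (g * s)))%:E) `^ s^-1)%E).
  apply: le_poweR; rewrite ?invr_ge0 ?(ltW s0)//.
    by rewrite !mule_ge0 ?poweR_ge0 ?lee_fin ?powR_ge0// integral_ge0.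
  by apply: lee_wpmul2l => //; rewrite mule_ge0 ?poweR_ge0// lee_fin powR_ge0.
set V := v x; have V0 : (0 <= V)%E by exact: v0.
rewrite poweRM ?mule_ge0 ?poweR_ge0 ?lee_fin ?powR_ge0//.
rewrite poweRM ?poweR_ge0 ?lee_fin ?powR_ge0//.
rewrite [leRHS](_ : _ = c1%:E * ((pweight b x)%:E `^ p * u x `^ p))%E; last first.
  by rewrite poweRM// lee_fin pweight_ge0.
rewrite -poweRrM !poweR_EFin -powRrM mulfV ?(gt_eqF s0)// powRr1// poweRe1//.
rewrite /V /v.
set X := (u x `^ p)%E.
have X0 : (0 <= X)%E by exact: poweR_ge0.
rewrite [leLHS](_ : _ = (c0 * ((x `^ (g - 1)) `^ (1 - p) *
    (2 * ((lam / x) `^ (g * s) / (g * s))) `^ s^-1))%:E * X)%E; last first.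
  by rewrite !EFinM -!muleA; congr (_ * _)%E; rewrite [RHS]muleA muleC.
rewrite [leRHS]muleA -EFinM; apply: lee_wpmul2r => //.
rewrite lee_fin /c1 /pweight (gt_eqF x0) gtr0_norm//.
rewrite -mulrA ler_wpM2l//.
have -> : 2 * ((lam / x) `^ (g * s) / (g * s)) =
   (2 / (g * s)) * (lam `^ (g * s) * x `^ (- (g * s))).
  rewrite powRM ?invr_ge0 ?(ltW lam0) ?(ltW x0)//.
  rewrite -(powR_inv1 (ltW x0)) -powRrM mulN1r; ring.
have gs20 : 0 <= (g * s)^-1 by rewrite invr_ge0 ltW.
rewrite powRM ?mulr_ge0 ?powR_ge0//.
rewrite powRM ?powR_ge0// -!powRrM.
rewrite mulNr -mulrA mulfV ?mulr1 ?(gt_eqF s0)//.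
rewrite [leLHS]mulrCA -mulrA ler_wpM2l ?powR_ge0//.
rewrite [leLHS]mulrCA ler_wpM2l ?powR_ge0//.
rewrite -powRD ?(gt_eqF x0) ?implybT//.
rewrite le_eqVlt; apply/orP; left; apply/eqP; congr (_ `^ _).
by rewrite /b /g; field; rewrite ?gt_eqF.
Qed.

(** After [pointwise], Minkowski's inequality moves the xi-norm inside the
    x-integral, where [section_bound] applies. *)
Lemma hardy_average :
  (Lnorm mu q%:E (fun xi : measurableTypeR R => (pweight a xi)%:E *
      \int[mu]_(x in `](0%R : R), (lam / `|xi : R|)%R[) u x)
   <= (c1 `^ p^-1)%:E * Lnorm mu p%:E (fun x => (pweight b x)%:E * u x))%E.
Proof.
have c10 : 0 <= c1 by rewrite mulr_ge0// mulr_ge0 ?powR_ge0.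
have mub : measurable_fun setT (fun x => ((pweight b x)%:E * u x) `^ p)%E.
  apply: (measurableT_comp (measurable_poweR _)).
  by apply: emeasurable_funM => //; apply/measurable_EFinP; exact: measurable_pweight.
rewrite !ge0_LnormE; first last.
- by move=> x; rewrite mule_ge0 ?lee_fin ?pweight_ge0// integral_ge0.
- by move=> x; rewrite mule_ge0 ?lee_fin ?pweight_ge0.
apply: (@le_trans _ _ (((\int[mu]_x Lnorm mu s%:E (fun xi => F (xi, x))) `^ s)
    `^ q^-1)%E).
  apply: le_poweR; rewrite ?invr_ge0 ?(ltW q0)//.
    by apply: integral_ge0 => x _; exact: poweR_ge0.
  apply: (@le_trans _ _ (\int[mu]_xi (\int[mu]_x F (xi, x)) `^ s)%E).
    by apply: le_integral_nonneg => [xi|xi]; [exact: poweR_ge0|exact: pointwise].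
  rewrite [leLHS](_ : _ =
      (Lnorm mu s%:E (fun xi => \int[mu]_x F (xi, x))) `^ s)%E; last first.
    rewrite poweR_Lnorm ?gt_eqF//.
    by apply: eq_integral => xi _; rewrite gee0_abs// integral_ge0.
  apply: le_poweR; rewrite ?(ltW s0) ?Lnorm_ge0//.
  exact: minkowski_integral.
rewrite -poweRrM (_ : s / q = p^-1); last first.
  by rewrite /s; field; rewrite ?gt_eqF.
rewrite -poweR_EFin -poweRM ?lee_fin//; last first.
  by apply: integral_ge0 => x _; exact: poweR_ge0.
apply: le_poweR; rewrite ?invr_ge0 ?(ltW p0)//.
  by apply: integral_ge0 => x _; exact: Lnorm_ge0.
rewrite -ge0_integralZl//; last first.
  by move=> x _; exact: poweR_ge0.
apply: le_integral_nonneg => x; first exact: Lnorm_ge0.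
exact: section_bound.
Qed.

End hardy.

(** * Hardy's inequality in mixed norms *)

Section scaling.
Context {disp} {T : measurableType disp} {R : realType}.
Variable mu : {measure set T -> \bar R}.

(** Rescaling a simple function below c f gives one below f, so homogeneity needs
    no measurability either. *)
Lemma integralZ_nonneg (c : R) (f : T -> \bar R) : 0 < c ->
  (forall x, 0 <= f x)%E ->
  (\int[mu]_x (c%:E * f x) = c%:E * \int[mu]_x f x)%E.
Proof.
have le (e : R) (h : T -> \bar R) : 0 < e -> (forall x, 0 <= h x)%E ->
    (\int[mu]_x (e%:E * h x) <= e%:E * \int[mu]_x h x)%E.
  move=> e0 h0; have eh0 x : (0 <= e%:E * h x)%E.
    by rewrite mule_ge0// lee_fin ltW.
  rewrite !ge0_integralTE//; apply: ge_ereal_sup => _ [w /= wh <-].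
  have ei0 : 0 <= e^-1 by rewrite invr_ge0 ltW.
  rewrite -lee_pdivrMl// -sintegralrM.
  apply: ereal_sup_ubound; exists (scale_nnsfun w ei0) => //= x.
  by rewrite EFinM -[leRHS]mul1e -(mulVf (lt0r_neq0 e0)) EFinM -muleA
    lee_wpmul2l// lee_fin.
move=> c0 f0; apply/eqP; rewrite eq_le le//=.
have ci0 : 0 < c^-1 by rewrite invr_gt0.
rewrite muleC -lee_pdivlMr// muleC.
rewrite [leLHS](_ : _ = \int[mu]_x (c^-1%:E * (c%:E * f x)))%E.
  by apply: le => // x; rewrite mule_ge0// lee_fin ltW.
by apply: eq_integral => x _; rewrite muleA -EFinM mulVf ?mul1e// gt_eqF.
Qed.

Lemma LnormZ_nonneg (c r : R) (f : T -> \bar R) : 0 <= c -> 0 < r ->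
  (forall x, 0 <= f x)%E ->
  (Lnorm mu r%:E (fun x => c%:E * f x) = c%:E * Lnorm mu r%:E f)%E.
Proof.
move=> c0 r0 f0; rewrite !ge0_LnormE//; last by move=> x; rewrite mule_ge0.
have [->|cn0] := eqVneq c 0.
  rewrite mul0e integral0_eq ?poweR0r ?invr_eq0 ?gt_eqF// => x _.
  by rewrite mul0e poweR0r// gt_eqF.
have {cn0}c0' : 0 < c by rewrite lt_neqAle eq_sym cn0.
under eq_integral => x _ do rewrite poweRM// poweR_EFin.
rewrite integralZ_nonneg ?powR_gt0//; last by move=> x; exact: poweR_ge0.
rewrite poweRM ?lee_fin ?powR_ge0//; last first.
  by apply: integral_ge0 => x _; exact: poweR_ge0.
by rewrite poweR_EFin -powRrM mulfV ?gt_eqF// powRr1.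
Qed.

Lemma le_Lnorm_nonneg (r : R) (f h : T -> \bar R) : 0 < r ->
  (forall x, 0 <= f x)%E -> (forall x, f x <= h x)%E ->
  (Lnorm mu r%:E f <= Lnorm mu r%:E h)%E.
Proof.
move=> r0 f0 fh; have h0 x : (0 <= h x)%E by exact: le_trans (fh x).
rewrite !ge0_LnormE//; apply: le_poweR; rewrite ?invr_ge0 ?(ltW r0)//.
  by apply: integral_ge0 => x _; exact: poweR_ge0.
apply: le_integral_nonneg => x; first exact: poweR_ge0.
by apply: le_poweR => //; exact: ltW.
Qed.

End scaling.

Section tuples.
Context {R : realType} {n : nat}.
Implicit Types (x : measurableTypeR R) (y : euc R n).

Lemma ecoord_cons0 x y : ecoord (cons_tuple x y : euc R n.+1) ord0 = x.
Proof. by []. Qed.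

Lemma ecoord_consS x y (k : 'I_n) :
  ecoord (cons_tuple x y : euc R n.+1) (lift ord0 k) = ecoord y k.
Proof. by rewrite /ecoord tnthS. Qed.

Lemma ecoord_evec {m} (F : 'I_m -> R) k : ecoord (evec F) k = F k.
Proof. by rewrite /ecoord tnth_mktuple. Qed.

Lemma ecoord_behead (s : euc R n.+1) (k : 'I_n) :
  ecoord (behead_tuple s : euc R n) k = ecoord s (lift ord0 k).
Proof.
rewrite /ecoord tnth_behead; congr tnth; apply: val_inj.
by rewrite /= inordK// ltnS ltn_ord.
Qed.

Lemma measurable_ecoord {m} (k : 'I_m) :
  measurable_fun [set: euc R m] (fun x : euc R m => ecoord x k).
Proof. exact: measurable_tnth. Qed.

Lemma weight_cons (a : euc R n.+1) x y :
  weight a (cons_tuple x y : euc R n.+1) =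
  pweight (ecoord a ord0) x * weight (behead_tuple a : euc R n) y.
Proof.
have E1 : \prod_(k < n) ecoord (cons_tuple x y : euc R n.+1) (lift ord0 k) =
    \prod_(k < n) ecoord y k by apply: eq_bigr => k _; rewrite ecoord_consS.
have E2 : \prod_(k < n) `|ecoord (cons_tuple x y : euc R n.+1) (lift ord0 k)|
      `^ ecoord a (lift ord0 k) =
    \prod_(k < n) `|ecoord y k| `^ ecoord (behead_tuple a : euc R n) k.
  by apply: eq_bigr => k _; rewrite ecoord_consS ecoord_behead.
rewrite /weight /pweight !big_ord_recl !ecoord_cons0 E1 E2.
rewrite mulf_eq0; case: eqVneq => _ /=; first by rewrite mul0r.
by case: ifPn; rewrite ?mulr0.
Qed.

Lemma weight_ge0 m (a x : euc R m) : 0 <= weight a x.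
Proof.
by rewrite /weight; case: ifPn => // _; apply: prodr_ge0 => k _; exact: powR_ge0.
Qed.

Lemma integral_lebesgueS (F : euc R n.+1 -> \bar R) :
  measurable_fun setT F -> (forall z, 0 <= F z)%E ->
  (\int[lebesgue n.+1]_z F z =
   \int[lebesgue_measure]_x \int[lebesgue n]_y F (cons_tuple x y))%E.
Proof.
move=> mF F0; rewrite /= /leb_cons.
rewrite ge0_integral_pushforward//; last exact: measurable_consp.
rewrite preimage_setT fubini_tonelli1//.
  by apply: measurableT_comp => //; exact: measurable_consp.
by move=> z; exact: F0.
Qed.

End tuples.

Section mixed_hardy.
Context {R : realType}.

Lemma le_mixed_norm_rec d (s : euc R d) (F G : euc R d -> \bar R) :
  (forall k, 0 < ecoord s k) -> (forall x, 0 <= F x)%E ->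
  (forall x, F x <= G x)%E ->
  (mixed_norm_rec s F <= mixed_norm_rec s G)%E.
Proof.
elim: d s F G => [|d IH] s F G s0 F0 FG /=; first exact: FG.
apply: IH => [k|y|y]; first by rewrite ecoord_behead.
  exact: Lnorm_ge0.
by apply: le_Lnorm_nonneg => //; exact: s0.
Qed.

Lemma mixed_norm_recZ d (s : euc R d) (c : R) (F : euc R d -> \bar R) :
  (forall k, 0 < ecoord s k) -> 0 <= c -> (forall x, 0 <= F x)%E ->
  mixed_norm_rec s (fun x => c%:E * F x)%E = (c%:E * mixed_norm_rec s F)%E.
Proof.
elim: d s F => [//|d IH] s F s0 c0 F0 /=.
rewrite -IH//; first last.
- by move=> y; exact: Lnorm_ge0.
- by move=> k; rewrite ecoord_behead.
congr mixed_norm_rec; apply/funext => y.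
by rewrite LnormZ_nonneg//; exact: s0.
Qed.

Lemma measurable_Qbox d (r : euc R d) : measurable (Qbox r).
Proof.
rewrite (_ : Qbox r = \bigcap_(k in [set: 'I_d])
    ((fun x : euc R d => ecoord x k) @^-1` `]0, ecoord r k[)); last first.
  apply/seteqP; split => x /= H k.
    by move=> _; rewrite /= in_itv/=; exact: H.
  by have := H k I; rewrite /= in_itv.
apply: fin_bigcap_measurable => [|k _]; first exact: finite_finset.
rewrite -[X in measurable X]setTI.
by apply: measurable_ecoord => //; exact: measurable_itv.
Qed.

(** The multidimensional Hardy operator. *)
Definition box_integral d (lam : euc R d) (h : euc R d -> \bar R)
    (xi : euc R d) : \bar R :=
  (\int[lebesgue d]_(x in Qbox (evec (fun k => ecoord lam k / `|ecoord xi k|)%R))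
     h x)%E.

Lemma in_Qbox_cons d (lam xi : euc R d.+1) (x : measurableTypeR R) (y : euc R d) :
  Qbox (evec (fun k => ecoord lam k / `|ecoord xi k|)) (cons_tuple x y : euc R d.+1)
  <-> `](0 : R), (ecoord lam ord0 / `|ecoord xi ord0|)[%classic x /\
      Qbox (evec (fun k => ecoord (behead_tuple lam : euc R d) k /
                       `|ecoord (behead_tuple xi : euc R d) k|)) y.
Proof.
rewrite /Qbox /= in_itv/=; split.
  move=> H; split; first by have := H ord0; rewrite ecoord_evec.
  by move=> k; have := H (lift ord0 k); rewrite !ecoord_evec !ecoord_behead ecoord_consS.
move=> [H0 H] k; rewrite ecoord_evec; case: (unliftP ord0 k) => [j|] ->//.
by have := H j; rewrite !ecoord_evec !ecoord_behead ecoord_consS.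
Qed.

Lemma box_integral_cons d (lam : euc R d.+1) (h : euc R d.+1 -> \bar R)
    (x1 : measurableTypeR R) (xi : euc R d) :
  measurable_fun setT h -> (forall z, 0 <= h z)%E ->
  (box_integral lam h (cons_tuple x1 xi) =
   \int[lebesgue_measure]_(x in `](0%R : R), (ecoord lam ord0 / `|x1 : R|)%R[)
     box_integral (behead_tuple lam) (fun y => h (cons_tuple x y)) xi)%E.
Proof.
move=> mh h0; rewrite /box_integral integral_mkcond integral_lebesgueS; last 2 first.
- by apply: (measurable_restrictT h (measurable_Qbox _)).1; exact: measurable_funTS.
- by move=> z; apply: erestrict_ge0.
have BE : behead_tuple (cons_tuple x1 xi) = xi by exact: val_inj.
rewrite [RHS]integral_mkcond; apply: eq_integral => x _.
rewrite [RHS]patchE; case: ifPn => xI.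
  rewrite [RHS]integral_mkcond; apply: eq_integral => y _; rewrite !patchE.
  have E : (cons_tuple x y : euc R d.+1) \in
      Qbox (evec (fun k => ecoord lam k / `|ecoord (cons_tuple x1 xi : euc R d.+1) k|)) =
    (y \in Qbox (evec (fun k => ecoord (behead_tuple lam : euc R d) k / `|ecoord xi k|))).
    apply/idP/idP; rewrite !inE => H.
      by have [_] := (in_Qbox_cons _ _ _ _).1 H; rewrite BE.
    apply/in_Qbox_cons; split; first by rewrite inE in xI.
    by rewrite BE.
  by rewrite E.
apply: integral0_eq => y _; rewrite patchE; case: ifPn => // /[!inE] H.
have [/mem_set] := (in_Qbox_cons _ _ _ _).1 H.
by rewrite (negbTE xI).
Qed.

Lemma hardy (p q a lam : R) : 1 <= p -> p <= q -> - q^-1 < a -> 0 < lam ->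
  exists2 C : R, 0 <= C &
  forall u : measurableTypeR R -> \bar R,
    measurable_fun setT u -> (forall x, 0 <= u x)%E ->
    (Lnorm lebesgue_measure q%:E (fun xi : measurableTypeR R => (pweight a xi)%:E *
        \int[lebesgue_measure]_(x in `](0%R : R), (lam / `|xi : R|)%R[) u x)
     <= C%:E * Lnorm lebesgue_measure p%:E
       (fun x => (pweight (1 - p^-1 - q^-1 - a) x)%:E * u x))%E.
Proof.
move=> p1 pq qa lam0; eexists; last by move=> u mu_ u0; exact: hardy_average.
exact: powR_ge0.
Qed.

(** Induction on the dimension.  The function H obtained from h by taking the
    weighted norm in the first variable depends on one variable less, and the
    inductive hypothesis is applied to it. *)
Lemma mixed_hardy d (p q a lam : euc R d) :
  (forall k, 1 <= ecoord p k <= ecoord q k) ->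
  (forall k, - (ecoord q k)^-1 < ecoord a k) ->
  (forall k, 0 < ecoord lam k) ->
  exists2 C : R, 0 <= C &
  forall h : euc R d -> \bar R,
    measurable_fun setT h -> (forall x, 0 <= h x)%E ->
    (mixed_norm_rec q (fun xi => (weight a xi)%:E * box_integral lam h xi)
     <= C%:E * mixed_norm_rec p (fun x =>
       (weight (evec (fun k => 1 - (ecoord p k)^-1 - (ecoord q k)^-1 - ecoord a k)) x)%:E
       * h x))%E.
Proof.
elim: d p q a lam => [|d IH] p q a lam pq qa lam0.
  exists 1 => // h mh h0; rewrite mul1e /= /box_integral.
  rewrite (_ : Qbox _ = setT); last by apply/seteqP; split => // x _ [].
  rewrite integral_dirac// diracT mul1e.
  by rewrite /weight !big_ord0 (negbTE (oner_neq0 _)).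
pose p' : euc R d := behead_tuple p; pose q' : euc R d := behead_tuple q.
pose a' : euc R d := behead_tuple a; pose lam' : euc R d := behead_tuple lam.
set b : euc R d.+1 := evec _.
pose b' : euc R d := behead_tuple b.
have [p1 pq0] := andP (pq ord0).
have p0 : 0 < ecoord p ord0 by exact: lt_le_trans p1.
have q0 : 0 < ecoord q ord0 by exact: lt_le_trans pq0.
have pq' k : 1 <= ecoord p' k <= ecoord q' k by rewrite !ecoord_behead.
have p'0 k : 0 < ecoord p' k.
  by have /andP[/(lt_le_trans ltr01)] := pq' k.
have q'0 k : 0 < ecoord q' k.
  by have /andP[_] := pq' k; exact: lt_le_trans.
have [C' C'0 HC'] : exists2 C : R, 0 <= C &
  forall h : euc R d -> \bar R,
    measurable_fun setT h -> (forall x, 0 <= h x)%E ->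
    (mixed_norm_rec q' (fun xi => (weight a' xi)%:E * box_integral lam' h xi)
     <= C%:E * mixed_norm_rec p' (fun x => (weight b' x)%:E * h x))%E.
  have [||C' C'0 HC'] := IH p' q' a' lam' pq'.
  - by move=> k; rewrite !ecoord_behead.
  - by move=> k; rewrite ecoord_behead.
  exists C' => // h mh h0; have := HC' h mh h0.
  rewrite (_ : evec _ = b')//; apply: eq_from_tnth => k.
  rewrite -[LHS]/(ecoord _ k) -[RHS]/(ecoord _ k).
  by rewrite ecoord_behead !ecoord_evec !ecoord_behead.
have [C1 C10 HC1] := hardy p1 pq0 (qa ord0) (lam0 ord0).
exists (C1 * C'); first by rewrite mulr_ge0.
move=> h mh h0 /=; rewrite -/p' -/q'.
pose H (y : euc R d) : \bar R := Lnorm lebesgue_measure (ecoord p ord0)%:E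
  (fun x : measurableTypeR R => (pweight (ecoord b ord0) x)%:E * h (cons_tuple x y))%E.
have H0 y : (0 <= H y)%E by exact: Lnorm_ge0.
have mhc : measurable_fun setT
    (fun z : measurableTypeR R * euc R d => h (cons_tuple z.1 z.2)).
  by apply: (measurableT_comp mh); exact: measurable_consp.
pose HF (z : measurableTypeR R * euc R d) :=
  ((pweight (ecoord b ord0) z.1)%:E * h (cons_tuple z.1 z.2))%E.
have HF0 z : (0 <= HF z)%E by rewrite mule_ge0// lee_fin pweight_ge0.
have mHF : measurable_fun setT HF.
  apply: emeasurable_funM => //; apply/measurable_EFinP.
  by apply: (measurableT_comp (measurable_pweight _)).
have mH : measurable_fun setT H by exact: (measurable_Lnorm_section _ _ mHF HF0).
(* Freeze the outer variables xi: Hardy's inequality in the first variable,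
   applied to the integral of h over the other variables, followed by
   Minkowski's inequality to let the norm enter that integral. *)
have inner (xi : euc R d) : (Lnorm lebesgue_measure (ecoord q ord0)%:E
   (fun x1 : measurableTypeR R => (weight a (cons_tuple x1 xi))%:E *
      box_integral lam h (cons_tuple x1 xi))
   <= C1%:E * ((weight a' xi)%:E * box_integral lam' H xi))%E.
  set Q := Qbox (evec (fun k => ecoord lam' k / `|ecoord xi k|)).
  pose u (x : measurableTypeR R) := ((weight a' xi)%:E *
    box_integral lam' (fun y => h (cons_tuple x y)) xi)%E.
  pose hQ (z : measurableTypeR R * euc R d) :=
    (((fun y => h (cons_tuple z.1 y)) \_ Q) z.2).
  have hQ0 z : (0 <= hQ z)%E by rewrite /hQ; apply: erestrict_ge0.
  have mhQ : measurable_fun setT hQ.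
    rewrite (_ : hQ = (fun z => h (cons_tuple z.1 z.2)) \_ (setT `*` Q)).
      apply: (measurable_restrictT _ _).1.
        by apply: measurableX => //; exact: measurable_Qbox.
      exact: measurable_funTS.
    apply/funext => z; rewrite /hQ !patchE.
    by congr (if _ then _ else _); apply/idP/idP; rewrite !inE => // -[].
  have boxE (f : euc R d -> \bar R) :
      box_integral lam' f xi = (\int[lebesgue d]_y (f \_ Q) y)%E.
    by rewrite /box_integral integral_mkcond.
  have box_ge0 (f : euc R d -> \bar R) : (forall y, 0 <= f y)%E ->
      (0 <= box_integral lam' f xi)%E.
    by move=> f0; apply: integral_ge0.
  have mbox : measurable_fun setT (fun x : measurableTypeR R =>
      box_integral lam' (fun y => h (cons_tuple x y)) xi).
    under eq_fun do rewrite boxE.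
    exact: (measurable_fun_fubini_tonelli_F hQ).
  have mu_ : measurable_fun setT u by apply: emeasurable_funM.
  have u0 x : (0 <= u x)%E by rewrite mule_ge0 ?lee_fin ?weight_ge0// box_ge0.
  rewrite [leLHS](_ : _ = Lnorm lebesgue_measure (ecoord q ord0)%:E
      (fun x1 : measurableTypeR R => (pweight (ecoord a ord0) x1)%:E *
       \int[lebesgue_measure]_(x in `](0%R : R),
          (ecoord lam ord0 / `|x1 : R|)%R[) u x)%E); last first.
    congr Lnorm; apply/funext => x1.
    rewrite weight_cons EFinM -muleA; congr (_ * _)%E.
    rewrite box_integral_cons//.
    rewrite -ge0_integralZl ?lee_fin ?weight_ge0//.
    - exact: measurable_funTS.
    - by move=> x _; exact: box_ge0.
  apply: (le_trans (HC1 u mu_ u0)).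
  apply: lee_wpmul2l; first by rewrite lee_fin.
  rewrite (_ : 1 - _ - _ - _ = ecoord b ord0); last by rewrite ecoord_evec.
  rewrite [leLHS](_ : _ = Lnorm lebesgue_measure (ecoord p ord0)%:E
    (fun x1 : measurableTypeR R => (weight a' xi)%:E *
      \int[lebesgue d]_y ((pweight (ecoord b ord0) x1)%:E * hQ (x1, y)))%E); last first.
    congr Lnorm; apply/funext => x1.
    rewrite /u muleCA boxE; congr (_ * _)%E.
    rewrite ge0_integralZl ?lee_fin ?pweight_ge0//.
    by apply: (measurableT_comp mhQ); exact: measurable_pair1.
  have pint0 x1 : (0 <= \int[lebesgue d]_y
      ((pweight (ecoord b ord0) x1)%:E * hQ (x1, y)))%E.
    by apply: integral_ge0 => y _; rewrite mule_ge0// lee_fin pweight_ge0.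
  rewrite LnormZ_nonneg ?weight_ge0//.
  apply: lee_wpmul2l; first by rewrite lee_fin weight_ge0.
  have := @minkowski_integral _ _ _ _ _ (@lebesgue_measure R) (lebesgue d) _
    (fun z => (pweight (ecoord b ord0) z.1)%:E * hQ z)%E p1.
  move=> /(_ _ _)/wrap[||/=].
  - apply: emeasurable_funM => //; apply/measurable_EFinP.
    by apply: (measurableT_comp (measurable_pweight _)).
  - by move=> z; rewrite mule_ge0// lee_fin pweight_ge0.
  move=> /le_trans; apply; rewrite boxE le_eqVlt; apply/orP; left; apply/eqP.
  apply: eq_integral => y _; rewrite [RHS]patchE /hQ/=.
  case: ifPn => yQ.
    by congr Lnorm; apply/funext => x; rewrite patchE yQ.
  rewrite -[RHS](@Lnorm0 _ _ _ (@lebesgue_measure R) (ecoord p ord0)%:E).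
    by congr Lnorm; apply/funext => x; rewrite patchE (negbTE yQ) mule0.
  by rewrite eqe gt_eqF.
apply: (@le_trans _ _ (mixed_norm_rec q' (fun xi => C1%:E *
   ((weight a' xi)%:E * box_integral lam' H xi)))%E).
  by apply: le_mixed_norm_rec => // xi; exact: Lnorm_ge0.
rewrite mixed_norm_recZ//; last first.
  by move=> xi; rewrite mule_ge0 ?lee_fin ?weight_ge0// integral_ge0.
rewrite EFinM -muleA; apply: lee_wpmul2l; first by rewrite lee_fin.
apply: (le_trans (HC' H mH H0)).
apply: lee_wpmul2l; first by rewrite lee_fin.
apply: le_mixed_norm_rec => // [y|y].
  by rewrite mule_ge0 ?lee_fin ?weight_ge0.
rewrite -LnormZ_nonneg ?weight_ge0//; last by move=> x; exact: (HF0 (x, y)).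
rewrite le_eqVlt; apply/orP; left; apply/eqP; congr Lnorm; apply/funext => x.
by rewrite weight_cons EFinM muleCA muleA.
Qed.

End mixed_hardy.

(** * Components of a complex Radon measure *)

Section integral_domination.
Context {disp} {T : measurableType disp} {R : realType}.
Variables (m : {measure set T -> \bar R}) (M : set T -> \bar R) (D : set T).
Hypotheses (M0 : M set0 = 0%E)
  (mM : forall E, measurable E -> E `<=` D -> (m E <= M E)%E).

Import HBNNSimple.

Let sintegral_range (h : T -> R) :
  sintegral M h = (\sum_(x \in range h) x%:E * M (h @^-1` [set x]))%E.
Proof.
rewrite (fsbig_widen (range h) setT)//= => x [_ Nfx] /=.
by rewrite preimage10// M0 mule0.
Qed.

(** The total variation is only known as a set function, and the integral against
    it is the supremum over simple functions; comparing the two suprema uses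
    nothing but the inequality between set functions. *)
Lemma ge0_integral_domination (phi : T -> \bar R) :
  (forall x, D x -> 0 <= phi x)%E ->
  (\int[m]_(x in D) phi x <= \int[M]_(x in D) phi x)%E.
Proof.
move=> phi0; rewrite ge0_integralE// /integral /=.
have phiD0 x : (0 <= (phi \_ D) x)%E by exact: erestrict_ge0.
have -> : ((phi \_ D)^\- = cst 0)%E.
  apply/funext => x.
  by rewrite (@ge0_funenegE _ _ setT)// ?inE// => y _; exact: phiD0.
have -> : ((phi \_ D)^\+ = phi \_ D)%E.
  apply/funext => x.
  by rewrite (@ge0_funeposE _ _ setT)// ?inE// => y _; exact: phiD0.
set N := (X in (_ - X)%E); have -> : N = 0%E.
  rewrite /N (_ : [set _ | _ in _] = [set 0%E]) ?ereal_sup1//.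
  have sM0 : sintegral M (cst 0 : T -> R) = 0%E.
    rewrite sintegral_range fsbig1// => r [t _ <-].
    by rewrite mul0e.
  apply/seteqP; split => [_ [h /= h0 <-]|_ ->].
    rewrite -sM0; apply: eq_sintegral => x /=; apply/eqP.
    by rewrite eq_le fun_ge0 andbT -lee_fin h0.
  by exists nnsfun0.
rewrite sube0; apply: ge_ereal_sup => _ [h /= hphi <-].
apply: (@le_trans _ _ (sintegral M h)); last first.
  by apply: ereal_sup_ubound; exists h.
rewrite sintegralE sintegral_range lee_fsum// => r [t _ <-].
have [->|ht0] := eqVneq (h t) 0; first by rewrite !mul0e.
apply: lee_wpmul2l; first by rewrite lee_fin.
apply: mM; first exact: measurable_sfunP.
move=> x /= hx; apply: contrapT => nDx.
have := hphi x; rewrite patchE memNset// hx lee_fin leNgt => /negP; apply.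
by rewrite lt_neqAle eq_sym ht0/=.
Qed.

End integral_domination.

Section radon_components.
Context {R : realType} {d : nat}.
Implicit Types (mu : complex_radon R d) (E : set (euc R d)).

Lemma measurable_coord_set (I : 'I_d -> set R) :
  (forall k, measurable (I k)) ->
  measurable [set x : euc R d | forall k, I k (ecoord x k)].
Proof.
move=> mI; rewrite (_ : mkset _ = \bigcap_(k in [set: 'I_d])
    ((fun x : euc R d => ecoord x k) @^-1` I k)); last first.
  by apply/seteqP; split => x /= H k; [move=> _; exact: H|exact: (H k Logic.I)].
apply: fin_bigcap_measurable => [|k _]; first exact: finite_finset.
rewrite -[X in measurable X]setTI.
by apply: (@measurable_ecoord R d k) => //; exact: mI.
Qed.

Lemma measurable_orthant : measurable (orthant : set (euc R d)).
Proof.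
rewrite (_ : orthant = [set x | forall k, `]0%R, +oo[%classic (ecoord x k)]).
  apply: (measurable_coord_set (I := fun=> `]0%R, +oo[%classic)) => k.
  exact: measurable_itv.
by apply/seteqP; split => x /= H k; have := H k; rewrite /= in_itv/= andbT.
Qed.

(** Closed boxes increasing to the orthant: they reduce statements about
    measurable sets to relatively compact ones. *)
Definition exhaustion (n : nat) : set (euc R d) :=
  [set x | forall k, n.+1%:R^-1 <= ecoord x k <= n.+1%:R].

Lemma measurable_exhaustion n : measurable (exhaustion n).
Proof.
rewrite (_ : exhaustion n =
  [set x | forall k, `[n.+1%:R^-1, n.+1%:R]%classic (ecoord x k)]).
  apply: (measurable_coord_set (I := fun=> `[n.+1%:R^-1, n.+1%:R]%classic)) => k.
  exact: measurable_itv.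
by apply/seteqP; split => x /= H k; have := H k; rewrite /= in_itv.
Qed.

Lemma exhaustion_ndseq m n : (m <= n)%N -> exhaustion m `<=` exhaustion n.
Proof.
move=> mn x H k; have /andP[H1 H2] := H k; apply/andP; split.
  by apply: le_trans H1; rewrite lef_pV2 ?posrE// ler_nat.
by apply: (le_trans H2); rewrite ler_nat.
Qed.

Lemma exhaustion_orthant n : exhaustion n `<=` orthant.
Proof. by move=> x H k; have /andP[+ _] := H k; exact: lt_le_trans. Qed.

Lemma bigcup_exhaustion : \bigcup_n exhaustion n = orthant.
Proof.
apply/seteqP; split => x; first by move=> [n _]; exact: exhaustion_orthant.
move=> x0.
pose N := (\max_(k < d) maxn (Num.truncn (ecoord x k)) (Num.truncn (ecoord x k)^-1))%N.
exists N => // k; have kN : (maxn (Num.truncn (ecoord x k)) (Num.truncn (ecoord x k)^-1) <= N)%N.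
  exact: (leq_bigmax k).
move: kN; rewrite geq_max => /andP[kN1 kN2].
apply/andP; split; last first.
  by apply/ltW/(lt_le_trans (truncnS_gt _)); rewrite ler_nat.
rewrite -[leRHS]invrK lef_pV2 ?posrE ?invr_gt0 ?x0//.
by apply/ltW/(lt_le_trans (truncnS_gt _)); rewrite ler_nat.
Qed.

Lemma relcompact_exhaustion n E : relcompact (E `&` exhaustion n).
Proof.
exists (evec (fun=> n.+1%:R^-1)), (evec (fun=> n.+1%:R)); split.
  by move=> k; rewrite ecoord_evec.
by move=> x [_ H] k; rewrite !ecoord_evec.
Qed.

Lemma total_variation0 mu : Defs.total_variation mu set0 = 0%E.
Proof.
rewrite /Defs.total_variation (_ : [set v | _] = [set 0%E]) ?ereal_sup1//.
apply/seteqP; split => [_ [n [F [_ HF ->]]]|_ ->] /=.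
  rewrite big1// => i _; have [_ _] := HF i; rewrite subset0 => ->.
  by rewrite !measure0 !subrr expr0n addr0 sqrtr0.
exists 0%N, (fun _ => set0); split; last by rewrite big_ord0.
  by move=> [].
by move=> [].
Qed.

Lemma total_variation_ge mu E F : measurable F -> relcompact F -> F `<=` E ->
  ((cabs (cmeas mu F))%:E <= Defs.total_variation mu E)%E.
Proof.
move=> mF cF FE; apply: ereal_sup_ubound => /=; exists 1%N, (fun _ => F).
split => //; last by rewrite big_ord1.
by move=> i j _ _ _; rewrite !ord1.
Qed.

Lemma normr_Re_le (z : R[i]) : `|complex.Re z| <= cabs z.
Proof.
case: z => x y /=; rewrite -sqrtr_sqr ler_sqrt ?addr_ge0 ?sqr_ge0//.
by rewrite lerDl sqr_ge0.
Qed.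

Lemma normr_Im_le (z : R[i]) : `|complex.Im z| <= cabs z.
Proof.
case: z => x y /=; rewrite -sqrtr_sqr ler_sqrt ?addr_ge0 ?sqr_ge0//.
by rewrite lerDr sqr_ge0.
Qed.

(** The features shared by the four Jordan components: nu lives on a set A on
    which it is, up to sign, the real or the imaginary part of mu. *)
Definition component mu (nu : {measure set (euc R d) -> \bar R}) :=
  positive_radon nu /\ exists A, [/\ measurable A, nu (orthant `\` A) = 0%E &
    forall F, measurable F -> F `<=` A `&` orthant ->
      fine (nu F) <= cabs (cmeas mu F)].

Lemma component_re_plus mu : component mu (re_plus mu).
Proof.
split; first exact: re_plus_radon.
have [A mA [pA mA0]] := re_singular mu; exists A; split => // F mF FA.
have -> : fine (re_plus mu F) = complex.Re (cmeas mu F).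
  rewrite /= [re_minus mu F](_ : _ = 0%E) ?subr0//.
  apply: (subset_measure0 (B := orthant `&` A)) => //.
  - by apply: measurableI => //; exact: measurable_orthant.
  - by move=> x /FA[].
exact: le_trans (ler_norm _) (normr_Re_le _).
Qed.

Lemma component_re_minus mu : component mu (re_minus mu).
Proof.
split; first exact: re_minus_radon.
have [A mA [pA mA0]] := re_singular mu; exists (~` A); split.
- exact: measurableC.
- by rewrite setDE setCK.
move=> F mF FA.
have -> : fine (re_minus mu F) = - complex.Re (cmeas mu F).
  rewrite /= [re_plus mu F](_ : _ = 0%E) ?sub0r ?opprK//.
  apply: (subset_measure0 (B := orthant `\` A)) => //.
  - by apply: measurableD => //; exact: measurable_orthant.
  - by move=> x /FA[].
by apply: le_trans (normr_Re_le _); rewrite ler_normr lexx orbT.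
Qed.

Lemma component_im_plus mu : component mu (im_plus mu).
Proof.
split; first exact: im_plus_radon.
have [A mA [pA mA0]] := im_singular mu; exists A; split => // F mF FA.
have -> : fine (im_plus mu F) = complex.Im (cmeas mu F).
  rewrite /= [im_minus mu F](_ : _ = 0%E) ?subr0//.
  apply: (subset_measure0 (B := orthant `&` A)) => //.
  - by apply: measurableI => //; exact: measurable_orthant.
  - by move=> x /FA[].
exact: le_trans (ler_norm _) (normr_Im_le _).
Qed.

Lemma component_im_minus mu : component mu (im_minus mu).
Proof.
split; first exact: im_minus_radon.
have [A mA [pA mA0]] := im_singular mu; exists (~` A); split.
- exact: measurableC.
- by rewrite setDE setCK.
move=> F mF FA.
have -> : fine (im_minus mu F) = - complex.Im (cmeas mu F).
  rewrite /= [im_plus mu F](_ : _ = 0%E) ?sub0r ?opprK//.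
  apply: (subset_measure0 (B := orthant `\` A)) => //.
  - by apply: measurableD => //; exact: measurable_orthant.
  - by move=> x /FA[].
by apply: le_trans (normr_Im_le _); rewrite ler_normr lexx orbT.
Qed.

(** On relatively compact pieces of the carrier A the value of nu is at most
    |mu(F)|, hence at most the total variation; exhaust E by such pieces. *)
Lemma component_le_total_variation mu nu E : component mu nu ->
  measurable E -> E `<=` orthant -> (nu E <= Defs.total_variation mu E)%E.
Proof.
move=> [nur [A [mA nuA le]]] mE Eo.
have mEA : measurable (E `&` A) by exact: measurableI.
have mEn n : measurable (E `&` A `&` exhaustion n).
  by apply: measurableI => //; exact: measurable_exhaustion.
have -> : nu E = nu (E `&` A).
  rewrite -[in LHS](setDUK (@subIsetl _ E A)) measureU//; last 2 first.
  - exact: measurableD.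
  - by rewrite setDIK.
  rewrite [X in (_ + X)%E](_ : _ = 0%E) ?adde0//.
  apply: (subset_measure0 (B := orthant `\` A)) => //.
  - exact: measurableD.
  - by apply: measurableD => //; exact: measurable_orthant.
  - by move=> x [Ex nEA]; split; [exact: Eo|move=> Ax; apply: nEA].
have EAE : E `&` A = \bigcup_n (E `&` A `&` exhaustion n).
  rewrite -setI_bigcupr bigcup_exhaustion; apply/seteqP; split => x; last by case.
  by move=> [Ex Ax]; split => //; exact: Eo.
have cv : nu (E `&` A `&` exhaustion n) @[n --> \oo] --> nu (E `&` A).
  rewrite [X in _ --> nu X]EAE; apply: nondecreasing_cvg_mu => //.
    by rewrite -EAE.
  move=> m n mn; apply/subsetPset; apply: setIS.
  exact: exhaustion_ndseq.
rewrite -(cvg_lim _ cv)//; apply: lime_le.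
  by apply/cvg_ex; eexists; exact: cv.
apply: nearW => n.
have cEn := @relcompact_exhaustion n (E `&` A).
rewrite -[leLHS]fineK; last by rewrite ge0_fin_numE// nur.
apply: (@le_trans _ _ (cabs (cmeas mu (E `&` A `&` exhaustion n)))%:E).
  rewrite lee_fin le// => x [[Ex Ax] _]; split => //; exact: Eo.
by apply: total_variation_ge => // x [[]].
Qed.

Lemma component_le_majorant mu nu (r : euc R d) : component mu nu -> orthant r ->
  (\int[nu]_(t in orthant)
     (\prod_(k < d) Num.min (ecoord r k) (ecoord t k))%:E <= majorant mu r)%E.
Proof.
move=> cnu r0; apply: ge0_integral_domination.
- exact: total_variation0.
- by move=> E mE Eo; exact: component_le_total_variation.
- move=> t t0; rewrite lee_fin; apply: prodr_ge0 => k _.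
  by rewrite le_min !ltW ?r0 ?t0.
Qed.

Lemma majorant_ge0 mu (r : euc R d) : orthant r -> (0 <= majorant mu r)%E.
Proof.
move=> r0; apply: le_trans (component_le_majorant (component_re_plus mu) r0).
apply: integral_ge0 => t t0; rewrite lee_fin; apply: prodr_ge0 => k _.
by rewrite le_min !ltW ?t0 ?r0.
Qed.

Lemma measurable_Qstar (x : euc R d) : measurable (Qstar x).
Proof.
rewrite (_ : Qstar x = [set t | forall k, `[ecoord x k, +oo[%classic (ecoord t k)]).
  apply: (measurable_coord_set (I := fun k => `[ecoord x k, +oo[%classic)) => k.
  exact: measurable_itv.
by apply/seteqP; split => t /= H k; have := H k; rewrite /= in_itv/= andbT.
Qed.

(** On Q*(x) the integrand of the majorant at x is the constant prod_k x_k, which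
    is positive: Chebyshev's inequality. *)
Lemma component_Qstar_lty mu nu (x : euc R d) : component mu nu -> orthant x ->
  (majorant mu x < +oo)%E -> (nu (Qstar x) < +oo)%E.
Proof.
move=> cnu x0 xoo.
have px0 : 0 < \prod_(k < d) ecoord x k by apply: prodr_gt0 => k _; exact: x0.
have sub : Qstar x `<=` orthant.
  by move=> t xt k; exact: lt_le_trans (x0 k) (xt k).
have mo := @measurable_orthant.
have : ((\prod_(k < d) ecoord x k)%:E * nu (Qstar x) < +oo)%E.
  apply: le_lt_trans xoo; apply: le_trans (component_le_majorant cnu x0).
  rewrite -[X in nu X](setIidl sub) -[nu _]integral_indic//; last exact: measurable_Qstar.
  rewrite -ge0_integralZl//; last 2 first.
  - by apply/measurable_EFinP; apply: measurable_indic; exact: measurable_Qstar.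
  - by rewrite lee_fin ltW.
  rewrite integral_mkcond [leRHS]integral_mkcond; apply: le_integral_nonneg => t.
    by apply: erestrict_ge0 => y _; rewrite -EFinM lee_fin mulr_ge0// ltW.
  rewrite !patchE; case: ifPn => // /[!inE] t0; rewrite -EFinM lee_fin indicE.
  have [|] := boolP (t \in Qstar x); rewrite ?inE => xt.
    rewrite mulr1; apply: ler_prod => k _.
    by rewrite ltW ?x0//= le_min lexx; exact: xt.
  rewrite mulr0; apply: prodr_ge0 => k _.
  by rewrite le_min !ltW ?x0 ?t0.
by apply: contraTT; rewrite -!leNgt !leye_eq => /eqP ->; rewrite gt0_muley.
Qed.

End radon_components.

Section orthant_restriction.
Context {R : realType} {d : nat}.
Variables (nu : {measure set (euc R d) -> \bar R}) (nur : positive_radon nu).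

(** Radon measures are only controlled on the orthant; the restriction there is
    sigma-finite, as Fubini's theorem requires.  The Radon property is an
    argument because the measure structure below depends on it. *)
Definition orthant_restriction of positive_radon nu :=
  mrestr nu (@measurable_orthant R d).

Local Notation restr := (orthant_restriction nur).

Let restr0 : restr set0 = 0%E. Proof. exact: measure0. Qed.
Let restr_ge0 E : (0 <= restr E)%E. Proof. exact: measure_ge0. Qed.
Let restr_sigma_additive : semi_sigma_additive restr.
Proof. exact: measure_semi_sigma_additive. Qed.

HB.instance Definition _ := isMeasure.Build _ _ _ restr
  restr0 restr_ge0 restr_sigma_additive.

Let restr_sigma_finite : sigma_finite setT restr.
Proof.
exists (fun n => exhaustion n `|` ~` orthant).
  apply/esym/seteqP; split => // x _; have [x0|x0] := pselect (orthant x).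
    by move: (x0); rewrite -bigcup_exhaustion => -[n _ nx]; exists n => //; left.
  by exists 0%N => //; right.
move=> n; split.
  apply: measurableU; first exact: measurable_exhaustion.
  by apply: measurableC; exact: measurable_orthant.
rewrite /restr /mrestr setIUl setICl setU0 [_ `&` _]setIidl; last first.
  exact: exhaustion_orthant.
rewrite -(setTI (exhaustion n)); apply: nur; last exact: relcompact_exhaustion.
by apply: measurableI => //; exact: measurable_exhaustion.
Qed.

HB.instance Definition _ := Measure_isSigmaFinite.Build _ _ _ restr
  restr_sigma_finite.

End orthant_restriction.

(** * Oscillatory integrals over damped boxes *)

Section oscillation.
Context {R : realType}.
Local Notation mu := (@lebesgue_measure R).
Implicit Types e t xi th x : R.

Lemma integral_opp (f : R -> \bar R) : measurable_fun setT f ->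
  (\int[mu]_x f (- x)%R = \int[mu]_x f x)%E.
Proof.
move=> mf; rewrite integralE [RHS]integralE; congr (_ - _)%E.
- rewrite -(ge0_integralN (measurable_funepos mf) (funepos_ge0 f)).
  by apply: eq_integral => x _; rewrite !unlock.
- rewrite -(ge0_integralN (measurable_funeneg mf) (funeneg_ge0 f)).
  by apply: eq_integral => x _; rewrite !unlock.
Qed.

Definition half_damped e t x : R := if (0 < x) && (x <= t) then expR (- (e * x)) else 0.

(** The indicator of [-t, t] damped by exp(-e|x|).  Leaving out the origin makes
    [dampedE] an exact identity, and makes the products below vanish on the
    coordinate hyperplanes, where f is arbitrary. *)
Definition damped e t x : R :=
  if (x != 0) && (`|x| <= t) then expR (- (e * `|x|)) else 0.

Lemma damped_ge0 e t x : 0 <= damped e t x.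
Proof. by rewrite /damped; case: ifPn => // _; exact: expR_ge0. Qed.

Lemma half_damped_ge0 e t x : 0 <= half_damped e t x.
Proof. by rewrite /half_damped; case: ifPn => // _; exact: expR_ge0. Qed.

Lemma dampedE e t x : damped e t x = half_damped e t x + half_damped e t (- x).
Proof.
rewrite /damped /half_damped oppr_gt0.
have [x0|x0|<-] := ltgtP 0 x; rewrite /= ?addr0 ?eqxx//.
- by rewrite gtr0_norm.
- by rewrite ltr0_norm// add0r.
Qed.

Lemma measurable_half_damped e t : measurable_fun setT (half_damped e t).
Proof.
apply: measurable_fun_ifT => //.
- by apply: measurable_and; [exact: measurable_fun_ltr|exact: measurable_fun_ler].
- apply: (measurableT_comp (@measurable_expR R)); apply: measurable_funN.
  exact: measurable_funM.
Qed.

(** The chain rule for the three functions from which the antiderivatives below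
    are assembled. *)
Lemma is_derive_expRZ e x :
  is_derive x 1 (fun x => expR (- (e * x))) (- e * expR (- (e * x))).
Proof.
have dg : is_derive x 1 (fun x : R => - (e * x)) (- e).
  by apply: is_derive_eq; rewrite /GRing.scale/= mulr1.
have := @is_derive1_comp R expR (fun x => - (e * x)) x _ _ (is_derive_expR _) dg.
by move=> h; apply: (is_derive_eq h); rewrite mulrC.
Qed.

Lemma is_derive_cosZ xi x :
  is_derive x 1 (fun x => cos (x * xi)) (- xi * sin (x * xi)).
Proof.
have dg : is_derive x 1 (fun x : R => x * xi) xi.
  by apply: is_derive_eq; rewrite /GRing.scale/= mulr0 add0r mulr1.
have := @is_derive1_comp R cos (fun x => x * xi) x _ _ (is_derive_cos _) dg.
by move=> h; apply: (is_derive_eq h); ring.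
Qed.

Lemma is_derive_sinZ xi x :
  is_derive x 1 (fun x => sin (x * xi)) (xi * cos (x * xi)).
Proof.
have dg : is_derive x 1 (fun x : R => x * xi) xi.
  by apply: is_derive_eq; rewrite /GRing.scale/= mulr0 add0r mulr1.
have := @is_derive1_comp R sin (fun x => x * xi) x _ _ (is_derive_sin _) dg.
by move=> h; apply: (is_derive_eq h); ring.
Qed.

Lemma FTC_half_damped e t (f F : R -> R) : 0 < t ->
  (forall x, is_derive x 1 F (expR (- (e * x)) * f x)) ->
  (forall x, derivable f x 1) ->
  (\int[mu]_x (half_damped e t x * f x)%:E = (F t - F 0)%:E)%E.
Proof.
move=> t0 dF df.
have cf : continuous (fun x => expR (- (e * x)) * f x).
  move=> x; apply: differentiable_continuous; apply/derivable1_diffP.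
  by apply: derivableM => //; have [] := is_derive_expRZ e x.
rewrite -(FTC2_is_derive t0 (fun x _ => dF x) (fun x _ => cf x)).
rewrite -integral_itv_obnd_cbnd; last first.
  apply/measurable_EFinP; apply: measurable_funTS.
  exact: continuous_measurable_fun.
rewrite [RHS]integral_mkcond; apply: eq_integral => x _.
rewrite patchE mem_setE in_itv/= /half_damped.
by case: ifPn => //; rewrite mul0r.
Qed.

Lemma integral_half_damped_le e t : 0 < e ->
  (\int[mu]_x (half_damped e t x)%:E <= (Num.max 0 (Num.min e^-1 t))%:E)%E.
Proof.
move=> e0; have [t0|t0] := leP t 0.
  rewrite integral0_eq ?lee_fin ?le_max ?lexx// => x _.
  rewrite /half_damped; case: ifPn => // /andP[x0 xt].
  by have := lt_le_trans x0 (le_trans xt t0); rewrite ltxx.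
have := @FTC_half_damped e t (cst 1) (fun x => - e^-1 * expR (- (e * x))) t0.
move=> /(_ _ _)/wrap[|x|].
- move=> x; apply: (is_derive_eq (is_deriveZ (- e^-1) (is_derive_expRZ e x))).
  by rewrite /GRing.scale/= mulrA mulrNN mulVf ?gt_eqF//= mul1r mulr1.
- exact: derivable_cst.
under eq_integral do rewrite mulr1.
move=> ->; rewrite mulr0 oppr0 expR0 mulr1 lee_fin le_max; apply/orP; right.
rewrite opprK le_min; apply/andP; split.
  by rewrite gerDr mulNr oppr_le0 mulr_ge0 ?expR_ge0// invr_ge0 ltW.
rewrite -(ler_pM2l e0) mulrDr mulNr mulrN mulrA mulfV ?gt_eqF// mul1r.
have := expR_ge1Dx (- (e * t)); lra.
Qed.

(** The antiderivative of exp(-e x) cos(x xi) is bounded by 2/|xi| on the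
    half-line, uniformly in e; the other bound is the length t. *)
Lemma integral_half_damped_cos e t xi : 0 < e -> xi != 0 ->
  exists2 c : R, `|c| <= 4 * Num.max 0 (Num.min `|xi|^-1 t) &
    (\int[mu]_x (half_damped e t x * cos (x * xi))%:E = c%:E)%E.
Proof.
move=> e0 xi0; have [t0|t0] := leP t 0.
  exists 0; first by rewrite normr0 mulr_ge0// le_max lexx.
  apply: integral0_eq => x _.
  rewrite /half_damped; case: ifPn => [/andP[x0 xt]|_]; last by rewrite mul0r.
  by have := lt_le_trans x0 (le_trans xt t0); rewrite ltxx.
have D0 : 0 < e ^+ 2 + xi ^+ 2 by rewrite ltr_pwDl ?exprn_gt0// sqr_ge0.
pose F x := (e ^+ 2 + xi ^+ 2)^-1 *
  (expR (- (e * x)) * (xi * sin (x * xi) - e * cos (x * xi))).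
have FE : (\int[mu]_x (half_damped e t x * cos (x * xi))%:E = (F t - F 0)%:E)%E.
  have dcos x : derivable (fun x => cos (x * xi)) x 1.
    by have [] := is_derive_cosZ xi x.
  apply: (FTC_half_damped t0 _ dcos) => x.
  have d1 := is_derive_expRZ e x.
  have d2 := is_deriveZ xi (is_derive_sinZ xi x).
  have d3 := is_deriveZ e (is_derive_cosZ xi x).
  have := is_deriveZ (e ^+ 2 + xi ^+ 2)^-1 (is_deriveM d1 (is_deriveB d2 d3)).
  move=> h; apply: (is_derive_eq h); rewrite /GRing.scale/=.
  have alg E S C : (e ^+ 2 + xi ^+ 2)^-1 *
      (E * (xi * (xi * C) - e * (- xi * S)) + (xi * S - e * C) * (- e * E)) = E * C.
    by field; rewrite gt_eqF.
  exact: alg.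
exists (F t - F 0) => //.
have xn0 : 0 < `|xi| by rewrite normr_gt0.
have Fb x : 0 <= x -> `|F x| <= 2 * `|xi|^-1.
  move=> x0; rewrite /F !normrM.
  rewrite gtr0_norm ?invr_gt0// gtr0_norm ?expR_gt0//.
  have h1 : `|xi * sin (x * xi) - e * cos (x * xi)| <= `|xi| + e.
    apply: (le_trans (ler_normB _ _)); rewrite !normrM (gtr0_norm e0).
    by rewrite lerD// ler_piMr ?sin_max ?cos_max// ltW.
  have h2 : expR (- (e * x)) <= 1.
    by rewrite -expR0 ler_expR oppr_le0 mulr_ge0// ltW.
  rewrite mulrC ler_pdivrMr//.
  apply: (@le_trans _ _ (`|xi| + e)).
    by rewrite -[leRHS]mul1r ler_pM ?expR_ge0.
  rewrite -(ler_pM2r xn0) [leRHS](_ : _ = 2 * (e ^+ 2 + xi ^+ 2)); last first.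
    by field; rewrite gt_eqF.
  rewrite -[xi ^+ 2](@real_normK _ xi) ?num_real//.
  have := sqr_ge0 (`|xi| - e); rewrite !expr2; nra.
have m0 : 0 <= Num.min `|xi|^-1 t by rewrite le_min invr_ge0 !ltW.
rewrite (max_r m0).
have b1 : `|F t - F 0| <= 4 * `|xi|^-1.
  apply: (le_trans (ler_normB _ _)); have := Fb t (ltW t0); have := Fb 0 (lexx _).
  lra.
have b2 : `|F t - F 0| <= t.
  rewrite -lee_fin -abse_EFin -FE.
  have mg : measurable_fun setT (fun x : measurableTypeR R =>
      (half_damped e t x * cos (x * xi))%:E).
    apply/measurable_EFinP; apply: measurable_funM.
      exact: measurable_half_damped.
    apply: (measurableT_comp (continuous_measurable_fun (@continuous_cos R))).
    exact: measurable_funM.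
  apply: (le_trans (le_abse_integral mu measurableT mg)).
  apply: (@le_trans _ _ (\int[mu]_x (half_damped e t x)%:E)%E).
    apply: le_integral_nonneg => x; first exact: abse_ge0.
    rewrite abse_EFin lee_fin normrM ger0_norm ?half_damped_ge0//.
    by rewrite ler_piMr ?half_damped_ge0// cos_max.
  apply: (le_trans (integral_half_damped_le t e0)).
  by rewrite lee_fin ge_max (ltW t0)/= ge_min lexx orbT.
have [_|_] := leP `|xi|^-1 t; first exact: b1.
by apply: (le_trans b2); rewrite ler_peMl ?(ltW t0)// ler1n.
Qed.

End oscillation.

Lemma integrable_dominated {disp} {T : measurableType disp} {R : realType}
    (m : {measure set T -> \bar R}) (k psi : T -> R) :
  measurable_fun setT k -> measurable_fun setT psi ->
  (forall x, 0 <= k x) -> (forall x, `|psi x| <= 1) ->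
  (\int[m]_x (k x)%:E < +oo)%E ->
  m.-integrable setT (fun x => (k x * psi x)%:E).
Proof.
move=> mk mpsi k0 psi1 koo; apply/integrableP; split.
  by apply/measurable_EFinP; exact: measurable_funM.
apply: le_lt_trans koo; apply: le_integral_nonneg => x; first exact: abse_ge0.
by rewrite abse_EFin lee_fin normrM ger0_norm// ler_piMr.
Qed.

Section damped_tensor.
Context {R : realType}.
Local Notation mu := (@lebesgue_measure R).

Lemma measurable_damped {disp} {T : measurableType disp} (e : R) (f g : T -> R) :
  measurable_fun setT f -> measurable_fun setT g ->
  measurable_fun setT (fun z => damped e (f z) (g z)).
Proof.
move=> mf mg; have mng : measurable_fun setT (fun z => `|g z|).
  exact: (measurableT_comp (@normr_measurable _ _)).
apply: measurable_fun_ifT => //.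
- apply: measurable_and; last exact: measurable_fun_ler.
  by apply: measurable_neg; exact: measurable_fun_eqr.
- apply: (measurableT_comp (@measurable_expR R)); apply: measurable_funN.
  exact: measurable_funM.
Qed.

Lemma integral_damped_le (e t : R) : 0 < e ->
  (\int[mu]_x (damped e t x)%:E <= (2 * Num.max 0 (Num.min e^-1 t))%:E)%E.
Proof.
move=> e0; under eq_integral do rewrite dampedE EFinD.
have mh : measurable_fun setT (fun x : R => (half_damped e t x)%:E).
  by apply/measurable_EFinP; exact: measurable_half_damped.
have h0 x : (0 <= (half_damped e t x)%:E)%E by rewrite lee_fin half_damped_ge0.
rewrite ge0_integralD//; last first.
  by apply: (measurableT_comp mh); exact: oppr_measurable.
rewrite (ge0_integralN mh)// mulrDl mul1r EFinD.
by apply: leeD; exact: integral_half_damped_le.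
Qed.

Lemma measurable_cos_affine {disp} {T : measurableType disp} (f : T -> R) :
  measurable_fun setT f -> measurable_fun setT (fun z => cos (f z)).
Proof.
exact: (measurableT_comp (continuous_measurable_fun (@continuous_cos R))).
Qed.

(** The reflection x |-> -x cancels the sine part, so the phase th factors out.
    This factorisation is what makes the integral over a box a product. *)
Lemma integral_damped_cos (e t xi : R) : 0 < e -> xi != 0 ->
  exists2 c : R, `|c| <= 8 * Num.max 0 (Num.min `|xi|^-1 t) &
    forall th, (\int[mu]_x (damped e t x * cos (th + x * xi))%:E = (cos th * c)%:E)%E.
Proof.
move=> e0 xi0; have [c cle cE] := integral_half_damped_cos t e0 xi0.
exists (2 * c) => [|th].
  by rewrite normrM ger0_norm// (le_trans (ler_wpM2l _ cle))// mulrA -natrM.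
have hoo : (\int[mu]_x (half_damped e t x)%:E < +oo)%E.
  by apply: le_lt_trans (integral_half_damped_le t e0) _; exact: ltry.
have int1 (f : R -> R) : measurable_fun setT f ->
    mu.-integrable setT (fun x => (half_damped e t x * cos (f x))%:E).
  move=> mf; apply: integrable_dominated => //.
  - exact: measurable_half_damped.
  - exact: measurable_cos_affine.
  - by move=> x; exact: half_damped_ge0.
  - by move=> x; exact: cos_max.
have mlin : measurable_fun setT (fun x : R => x * xi) by exact: measurable_funM.
have mp : measurable_fun setT (fun x : R => th + x * xi) by exact: measurable_funD.
have mm : measurable_fun setT (fun x : R => th - x * xi) by exact: measurable_funB.
have [mi _] := integrableP _ _ _ (int1 _ mm).
have e2 := integral_opp mi.
have i2 : mu.-integrable setT (fun x : R => (half_damped e t (- x) * cos (th + x * xi))%:E).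
  apply: (@integrable_dominated _ _ _ mu (fun x : R => half_damped e t (- x))
    (fun x : R => cos (th + x * xi))) => //.
  - apply: (measurableT_comp (measurable_half_damped e t)).
    exact: oppr_measurable.
  - exact: measurable_cos_affine.
  - by move=> x; exact: half_damped_ge0.
  - by move=> x; exact: cos_max.
  - rewrite (ge0_integralN (f := fun x => (half_damped e t x)%:E))//.
      by apply/measurable_EFinP; exact: measurable_half_damped.
    by move=> x; rewrite lee_fin half_damped_ge0.
under eq_integral do rewrite dampedE mulrDl EFinD.
rewrite integralD//; last exact: int1.
have -> : (\int[mu]_x (half_damped e t (- x) * cos (th + x * xi))%:E =
           \int[mu]_x (half_damped e t x * cos (th - x * xi))%:E)%E.
  by rewrite -e2; apply: eq_integral => x _; rewrite mulNr opprK.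
rewrite -integralD//; [|exact: int1|exact: int1].
transitivity (\int[mu]_x ((2 * cos th)%:E * (half_damped e t x * cos (x * xi))%:E))%E.
  apply: eq_integral => x _; rewrite -EFinD -EFinM; congr EFin.
  by rewrite cosD cosB; ring.
by rewrite integralZl//; [rewrite cE -EFinM; congr EFin; ring|exact: int1].
Qed.

Definition damped_box {d} (e t x : euc R d) : R :=
  \prod_(k < d) damped (ecoord e k) (ecoord t k) (ecoord x k).

Lemma damped_box_ge0 d (e t x : euc R d) : 0 <= damped_box e t x.
Proof. by apply: prodr_ge0 => k _; exact: damped_ge0. Qed.

Lemma damped_box_cons d (e t : euc R d.+1) (x : measurableTypeR R) (y : euc R d) :
  damped_box e t (cons_tuple x y) =
  damped (ecoord e ord0) (ecoord t ord0) x *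
  damped_box (behead_tuple e : euc R d) (behead_tuple t) y.
Proof.
rewrite /damped_box big_ord_recl; congr (_ * _); apply: eq_bigr => k _.
by rewrite ecoord_consS !ecoord_behead.
Qed.

Lemma measurable_damped_box {disp} {T : measurableType disp} d (e : euc R d)
    (f g : T -> euc R d) :
  measurable_fun setT f -> measurable_fun setT g ->
  measurable_fun setT (fun z => damped_box e (f z) (g z)).
Proof.
move=> mf mg; apply: measurable_prod => k _; apply: measurable_damped.
  exact: (measurableT_comp (measurable_ecoord k)).
exact: (measurableT_comp (measurable_ecoord k)).
Qed.

Lemma measurable_phase {disp} {T : measurableType disp} d (th : R) (xi : euc R d)
    (g : T -> euc R d) : measurable_fun setT g ->
  measurable_fun setT (fun z => th + \sum_(k < d) ecoord (g z) k * ecoord xi k).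
Proof.
move=> mg; apply: measurable_funD => //; apply: measurable_sum => k.
apply: measurable_funM => //.
exact: (measurableT_comp (measurable_ecoord k)).
Qed.

(** Bounds the whole mass of a damped box; it only serves to justify the
    exchanges of integrals, so its dependence on e is harmless. *)
Lemma integral_damped_box_le d (e t : euc R d) : (forall k, 0 < ecoord e k) ->
  (\int[lebesgue d]_x (damped_box e t x)%:E <=
   (\prod_(k < d) (2 * Num.max 0 (Num.min (ecoord e k)^-1 (ecoord t k))))%:E)%E.
Proof.
have mk d' (e' t' : euc R d') : measurable_fun setT (fun x => (damped_box e' t' x)%:E).
  by apply/measurable_EFinP; exact: measurable_damped_box.
elim: d e t => [|d IH] e t e0.
  rewrite /= integral_dirac//; last exact: mk.
  by rewrite diracT mul1e /damped_box !big_ord0.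
have k0 d' (e' t' x : euc R d') : (0 <= (damped_box e' t' x)%:E)%E.
  by rewrite lee_fin damped_box_ge0.
rewrite integral_lebesgueS//.
pose J := (\int[lebesgue d]_y (damped_box (behead_tuple e) (behead_tuple t) y)%:E)%E.
rewrite (_ : (\int[mu]_x _)%E = (\int[mu]_x
    ((damped (ecoord e ord0) (ecoord t ord0) x)%:E * J))%E); last first.
  apply: eq_integral => x _; rewrite /J -ge0_integralZl ?lee_fin ?damped_ge0//; last exact: mk.
  by apply: eq_integral => y _; rewrite damped_box_cons EFinM.
rewrite ge0_integralZr//; last 3 first.
- by apply/measurable_EFinP; exact: measurable_damped.
- by move=> x _; rewrite lee_fin damped_ge0.
- exact: integral_ge0.
rewrite big_ord_recl EFinM; apply: lee_pmul.
- by apply: integral_ge0 => x _; rewrite lee_fin damped_ge0.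
- exact: integral_ge0.
- exact: integral_damped_le.
apply: le_trans (IH _ _ _) _; first by move=> k; rewrite ecoord_behead.
rewrite lee_fin le_eqVlt; apply/orP; left; apply/eqP.
by apply: eq_bigr => k _; rewrite !ecoord_behead.
Qed.

Lemma integral_lebesgueS_integrable d (F : euc R d.+1 -> \bar R) :
  (lebesgue d.+1).-integrable setT F ->
  (\int[lebesgue d.+1]_z F z = \int[mu]_x \int[lebesgue d]_y F (cons_tuple x y))%E.
Proof.
move=> /integrableP[mF Foo].
have mcons := @measurable_consp R d.
have iF : (mu \x lebesgue d)%E.-integrable setT (F \o @consp R d).
  apply/integrableP; split; first exact: measurableT_comp.
  move: Foo; rewrite /= /leb_cons ge0_integral_pushforward//.
  exact: measurableT_comp.
rewrite /= /leb_cons integral_pushforward//.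
by rewrite preimage_setT -(integral12_prod_meas1 iF).
Qed.

(** Keeping a free phase th replaces complex exponentials: the coordinates that
    are integrated last only enter the inner integral as a phase. *)
Lemma integral_damped_box_cos d (e t xi : euc R d) :
  (forall k, 0 < ecoord e k) -> (forall k, ecoord xi k != 0) ->
  exists2 c : R,
    `|c| <= \prod_(k < d) (8 * Num.max 0 (Num.min `|ecoord xi k|^-1 (ecoord t k))) &
    forall th, (\int[lebesgue d]_x
      (damped_box e t x * cos (th + \sum_(k < d) ecoord x k * ecoord xi k))%:E
      = (cos th * c)%:E)%E.
Proof.
elim: d e t xi => [|d IH] e t xi e0 xi0.
  exists 1 => [|th]; first by rewrite big_ord0 normr1.
  rewrite /= integral_dirac//; last first.
    apply/measurable_EFinP; apply: measurable_funM; first exact: measurable_damped_box.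
    by apply: measurable_cos_affine; exact: measurable_phase.
  by rewrite diracT mul1e /damped_box !big_ord0 addr0 mul1r mulr1.
have [||c' c'le c'E] := IH (behead_tuple e) (behead_tuple t) (behead_tuple xi).
- by move=> k; rewrite ecoord_behead.
- by move=> k; rewrite ecoord_behead.
have [c1 c1le c1E] := integral_damped_cos (ecoord t ord0) (e0 ord0) (xi0 ord0).
exists (c1 * c') => [|th].
  rewrite normrM big_ord_recl ler_pM//; apply: (le_trans c'le).
  rewrite le_eqVlt; apply/orP; left; apply/eqP.
  by apply: eq_bigr => k _; rewrite !ecoord_behead.
rewrite integral_lebesgueS_integrable; last first.
  apply: integrable_dominated.
  - exact: measurable_damped_box.
  - by apply: measurable_cos_affine; exact: measurable_phase.
  - by move=> x; exact: damped_box_ge0.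
  - by move=> x; exact: cos_max.
  - exact: le_lt_trans (integral_damped_box_le t e0) (ltry _).
rewrite (_ : (\int[mu]_x _)%E = (\int[mu]_x
    ((damped (ecoord e ord0) (ecoord t ord0) x *
      cos (th + x * ecoord xi ord0))%:E * c'%:E))%E); last first.
  apply: eq_integral => x _.
  rewrite [RHS](_ : _ = (damped (ecoord e ord0) (ecoord t ord0) x)%:E *
    (cos (th + x * ecoord xi ord0) * c')%:E)%E; last first.
    by rewrite -!EFinM mulrA.
  rewrite -c'E -integralZl//; last first.
    apply: integrable_dominated.
    - exact: measurable_damped_box.
    - by apply: measurable_cos_affine; exact: measurable_phase.
    - by move=> y; exact: damped_box_ge0.
    - by move=> y; exact: cos_max.
    - apply: le_lt_trans (integral_damped_box_le _ _) (ltry _) => k.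
      by rewrite ecoord_behead.
  apply: eq_integral => y _; rewrite damped_box_cons -EFinM mulrA.
  congr (_ * cos _)%:E; rewrite big_ord_recl ecoord_cons0 addrA.
  by congr (_ + _); apply: eq_bigr => k _; rewrite ecoord_consS ecoord_behead.
rewrite integralZr//.
  by rewrite c1E -EFinM mulrA.
apply: integrable_dominated.
- exact: measurable_damped.
- by apply: measurable_cos_affine; apply: measurable_funD => //; exact: measurable_funM.
- by move=> x; exact: damped_ge0.
- by move=> x; exact: cos_max.
- by apply: le_lt_trans (integral_damped_le _ _) (ltry _).
Qed.

End damped_tensor.

(** * The Fourier transform of a tail *)

Section tail_fourier.
Context {R : realType} {d : nat}.
Implicit Types (e t x xi : euc R d) (th : R).

(** With c = 1, the integrand of the majorant extended by 0 outside the orthant. *)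
Definition trunc_prod (c : R) (r t : euc R d) : R :=
  \prod_(k < d) (c * Num.max 0 (Num.min (ecoord r k) (ecoord t k))).

Lemma measurable_trunc_prod c r :
  measurable_fun setT (fun t => (trunc_prod c r t)%:E).
Proof.
apply/measurable_EFinP; apply: measurable_prod => k _.
apply: measurable_funM => //; apply: measurable_maxr => //.
by apply: measurable_minr => //; exact: measurable_ecoord.
Qed.

Definition einv x : euc R d := evec (fun k => `|ecoord x k|^-1).
Definition eabs x : euc R d := evec (fun k => `|ecoord x k|).

Lemma orthant_einv x : (forall k, ecoord x k != 0) -> orthant (einv x).
Proof. by move=> x0 k; rewrite ecoord_evec invr_gt0 normr_gt0. Qed.

Lemma prod_neq0P x : reflect (forall k, ecoord x k != 0) (\prod_(k < d) ecoord x k != 0).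
Proof.
apply: (iffP idP) => [|H]; last by apply/prodf_neq0 => k _; exact: H.
by move/prodf_neq0 => H k; exact: H.
Qed.

Section sigma_finite.
Variable m : {sigma_finite_measure set (euc R d) -> \bar R}.
Variables e xi : euc R d.
Hypotheses (e0 : forall k, 0 < ecoord e k) (xi0 : forall k, ecoord xi k != 0).
Hypothesis moo : (\int[m]_t (trunc_prod 2 (einv e) t)%:E < +oo)%E.

Definition phase th x : R := th + \sum_(k < d) ecoord x k * ecoord xi k.

Let J th (z : euc R d * euc R d) : \bar R :=
  (damped_box e z.2 z.1 * cos (phase th z.1))%:E.

Let mker : measurable_fun setT (fun z : euc R d * euc R d => damped_box e z.2 z.1).
Proof. exact: measurable_damped_box. Qed.

Let mcos th : measurable_fun setT (fun z : euc R d * euc R d => cos (phase th z.1)).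
Proof. by apply: measurable_cos_affine; exact: measurable_phase. Qed.

Let integrable_J th : (lebesgue d \x m)%E.-integrable setT (J th).
Proof.
apply: (integrable_dominated mker (mcos th)).
- by move=> z; exact: damped_box_ge0.
- by move=> z; exact: cos_max.
have mk : measurable_fun setT (fun z : euc R d * euc R d => (damped_box e z.2 z.1)%:E).
  exact/measurable_EFinP.
have k0 (z : euc R d * euc R d) : (0 <= (damped_box e z.2 z.1)%:E)%E.
  by rewrite lee_fin damped_box_ge0.
rewrite fubini_tonelli1// fubini_tonelli//.
apply: le_lt_trans moo; apply: le_integral_nonneg => t.
  by apply: integral_ge0 => x _; rewrite lee_fin damped_box_ge0.
apply: (le_trans (integral_damped_box_le t e0)).
rewrite lee_fin le_eqVlt; apply/orP; left; apply/eqP; apply: eq_bigr => k _.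
by rewrite ecoord_evec gtr0_norm.
Qed.

Lemma integrable_damped_box th :
  (lebesgue d).-integrable setT
    (fun x => \int[m]_t (damped_box e t x * cos (phase th x))%:E)%E.
Proof. exact: (integrable_fubini_F (integrable_J th)). Qed.

(** After Fubini, the inner integral over x is the one computed in
    [integral_damped_box_cos]. *)
Lemma abse_integral_damped_box_le th :
  (`|\int[lebesgue d]_x \int[m]_t (damped_box e t x * cos (phase th x))%:E| <=
   \int[m]_t (trunc_prod 8 (einv xi) t)%:E)%E.
Proof.
have iJ := integrable_J th.
rewrite (Fubini iJ).
have mG := measurable_fubini_G iJ.
apply: (le_trans (le_abse_integral _ measurableT mG)).
apply: le_integral_nonneg => t; first exact: abse_ge0.
have [c cle cE] := integral_damped_box_cos t e0 xi0.
rewrite /fubini_G /J /phase/= cE abse_EFin lee_fin normrM.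
rewrite (le_trans (y := `|c|))//; first by rewrite ler_piMl// cos_max.
apply: (le_trans cle); rewrite le_eqVlt; apply/orP; left; apply/eqP.
by apply: eq_bigr => k _; rewrite ecoord_evec.
Qed.

End sigma_finite.

(** The damped box, seen as a function of t, is a multiple of the indicator of
    Q*(|x|): integrating it against a measure in t produces a tail. *)
Lemma damped_boxE e t x : damped_box e t x =
  if \prod_(k < d) ecoord x k == 0 then 0 else
  expR (- \sum_(k < d) ecoord e k * `|ecoord x k|) * \1_(Qstar (eabs x)) t.
Proof.
case: eqP => [/eqP|/eqP/prod_neq0P xn0].
  rewrite prodf_seq_eq0 => /hasP[k _ /= /eqP xk0].
  apply/eqP; rewrite prodf_seq_eq0; apply/hasP; exists k; first exact: mem_index_enum.
  by rewrite /= /damped xk0 eqxx.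
rewrite indicE; have [|] := boolP (t \in Qstar (eabs x)); rewrite !(inE, notin_setE) => H.
  rewrite mulr1 -sumrN expR_sum; apply: eq_bigr => k _.
  by rewrite /damped xn0/=; have := H k; rewrite ecoord_evec => ->.
rewrite mulr0; apply/eqP; rewrite prodf_seq_eq0.
have [k Hk] : exists k, ~~ (`|ecoord x k| <= ecoord t k).
  apply: contrapT => nH; apply: H => k; rewrite ecoord_evec.
  by apply: contrapT => /negP nk; apply: nH; exists k.
apply/hasP; exists k; first exact: mem_index_enum.
by rewrite /= /damped (negbTE Hk) andbF.
Qed.

Lemma eabs_orthant x : (forall k, ecoord x k != 0) -> orthant (eabs x).
Proof. by move=> x0 k; rewrite ecoord_evec normr_gt0. Qed.

(** A real component of the integrand of the damped Fourier transform of the tail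
    of nu: the phase th is 0 for the cosine and - pi / 2 for the sine. *)
Definition osc_tail (nu : set (euc R d) -> \bar R) e xi th x : R :=
  if \prod_(k < d) ecoord x k == 0 then 0 else
  fine (nu (Qstar (eabs x))) *
  (expR (- \sum_(k < d) ecoord e k * `|ecoord x k|) * cos (phase xi th x)).

(** The tail is the integral of damped boxes against nu, so the bound on each box
    integrates to the majorant. *)
Lemma osc_tail_bound (mu : complex_radon R d) (nu : {measure set (euc R d) -> \bar R})
    e xi th :
  component mu nu -> (forall r, orthant r -> (majorant mu r < +oo)%E) ->
  (forall k, 0 < ecoord e k) -> (forall k, ecoord xi k != 0) ->
  (lebesgue d).-integrable setT (fun x => (osc_tail nu e xi th x)%:E) /\
  `|\int[lebesgue d]_x osc_tail nu e xi th x| <= 8 ^+ d * fine (majorant mu (einv xi)).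
Proof.
move=> cnu Moo e0 xi0; have [nur _] := cnu.
pose m : {sigma_finite_measure set (euc R d) -> \bar R} := orthant_restriction nur.
have mle (c : R) r : 0 <= c -> orthant r ->
    (\int[m]_t (trunc_prod c r t)%:E <= (c ^+ d)%:E * majorant mu r)%E.
  move=> c0 r0.
  under eq_integral => t _.
    rewrite /trunc_prod big_split/= prodr_const card_ord EFinM.
    over.
  rewrite ge0_integralZl//; last 3 first.
  - have := @measurable_trunc_prod 1 r; congr measurable_fun.
    by apply/funext => t; congr EFin; apply: eq_bigr => k _; rewrite mul1r.
  - by move=> t _; rewrite lee_fin; apply: prodr_ge0 => k _; rewrite le_max lexx.
  - by rewrite lee_fin exprn_ge0.
  apply: lee_wpmul2l; first by rewrite lee_fin exprn_ge0.
  rewrite (_ : (\int[m]_t _)%E = (\int[m]_(t in orthant)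
      (\prod_(k < d) Num.min (ecoord r k) (ecoord t k))%:E)%E); last first.
    rewrite [RHS]integral_mkcond; apply: eq_integral => t _; rewrite patchE.
    have [|] := boolP (t \in orthant); rewrite !(inE, notin_setE) => H.
      congr EFin; apply: eq_bigr => k _; apply: max_r.
      by rewrite le_min !ltW ?r0 ?H.
    have [k Hk] : exists k, ~~ (0 < ecoord t k).
      apply: contrapT => nH; apply: H => k.
      by apply: contrapT => /negP nk; apply: nH; exists k.
    congr EFin; apply/eqP; rewrite prodf_seq_eq0.
    apply/hasP; exists k; first exact: mem_index_enum.
    by rewrite /= max_l// ge_min [X in _ || X]leNgt Hk orbT.
  apply: ge0_integral_domination.
  - exact: total_variation0.
  - move=> E mE Eo; rewrite /m /= /orthant_restriction /mrestr (setIidl Eo).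
    exact: component_le_total_variation.
  - move=> t t0; rewrite lee_fin; apply: prodr_ge0 => k _.
    by rewrite le_min !ltW ?r0 ?t0.
have moo : (\int[m]_t (trunc_prod 2 (einv e) t)%:E < +oo)%E.
  have oe : orthant (einv e) by apply: orthant_einv => k; rewrite gt_eqF.
  apply: le_lt_trans (mle 2 (einv e) _ oe) _ => //.
  have := Moo _ oe; case: (majorant mu (einv e)) => [r _||]//.
    by rewrite -EFinM ltry.
  by rewrite gt0_muleNy ?lte_fin ?exprn_gt0// ltNyr.
have oscE x : (\int[m]_t (damped_box e t x * cos (phase xi th x))%:E =
    (osc_tail nu e xi th x)%:E)%E.
  rewrite /osc_tail; under eq_integral do rewrite damped_boxE.
  case: eqP => [_|/eqP/prod_neq0P x0].
    by apply: integral0_eq => t _; rewrite mul0r.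
  have ox := eabs_orthant x0.
  have so : Qstar (eabs x) `<=` orthant.
    by move=> t xt k; exact: lt_le_trans (ox k) (xt k).
  set c := expR _; set s := cos _.
  transitivity (\int[m]_t ((c * s)%:E * (\1_(Qstar (eabs x)) t)%:E))%E.
    by apply: eq_integral => t _; rewrite -EFinM; congr EFin; ring.
  rewrite integralZl//; last first.
    apply/integrableP; split.
      by apply/measurable_EFinP; apply: measurable_indic; exact: measurable_Qstar.
    under eq_integral do rewrite abse_EFin ger0_norm//.
    rewrite integral_indic//; last exact: measurable_Qstar.
    rewrite setIT /m/= /orthant_restriction /mrestr (setIidl so).
    exact: component_Qstar_lty (Moo _ ox).
  rewrite integral_indic//; last exact: measurable_Qstar.
  rewrite setIT /m/= /orthant_restriction /mrestr (setIidl so).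
  rewrite -[X in (_ * X)%E]fineK -?EFinM; first by congr EFin; ring.
  by rewrite ge0_fin_numE//; exact: component_Qstar_lty (Moo _ ox).
have ik := integrable_damped_box xi e0 moo th.
have ie : (lebesgue d).-integrable setT (fun x => (osc_tail nu e xi th x)%:E).
  by apply: eq_integrable ik => // x _; exact: oscE.
split=> //.
have := abse_integral_damped_box_le e0 xi0 moo th.
under eq_integral do rewrite oscE.
move=> /le_trans/(_ (mle 8 _ (ler0n _ _) (orthant_einv xi0))).
have := Moo _ (orthant_einv xi0).
have := majorant_ge0 mu (orthant_einv xi0).
case: (majorant mu (einv xi)) => [M _ _|//|//].
by rewrite -EFinM /= /Rintegral; case: (\int[lebesgue d]_x _)%E.
Qed.

End tail_fourier.

(** * The damped Fourier transform of an even potential *)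

Section hyperplanes.
Context {R : realType}.

Lemma measurable_zero_coord d :
  measurable [set x : euc R d | \prod_(k < d) ecoord x k = 0].
Proof.
rewrite (_ : mkset _ = (fun x : euc R d => \prod_(k < d) ecoord x k) @^-1` [set 0])//.
rewrite -[X in measurable X]setTI.
have mp : measurable_fun setT (fun x : euc R d => \prod_(k < d) ecoord x k).
  by apply: measurable_prod => k _; exact: measurable_ecoord.
exact: mp.
Qed.

(** For fixed x_1 <> 0 the section of the hyperplanes is the same set in one
    dimension less. *)
Lemma lebesgue_zero_coord d :
  lebesgue d [set x : euc R d | \prod_(k < d) ecoord x k = 0] = 0%E.
Proof.
elim: d => [|d IH].
  rewrite (_ : mkset _ = set0) ?measure0//; apply/seteqP; split => // x /=.
  by rewrite big_ord0 => /eqP; rewrite oner_eq0.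
have indicE' n (A : set (euc R n)) : measurable A ->
    lebesgue n A = (\int[lebesgue n]_x (\1_A x)%:E)%E.
  by move=> mA; rewrite integral_indic// setIT.
rewrite indicE'; last exact: measurable_zero_coord.
have mI : measurable_fun setT (fun x : euc R d.+1 =>
    (\1_[set x : euc R d.+1 | \prod_(k < d.+1) ecoord x k = 0] x)%:E : \bar R).
  by apply/measurable_EFinP; apply: measurable_indic; exact: measurable_zero_coord.
rewrite (integral_lebesgueS mI)//.
rewrite (@ge0_negligible_integral _ (measurableTypeR R) R
  (@lebesgue_measure R) setT [set (0 : R)])//; last 3 first.
- apply: (measurable_fun_fubini_tonelli_F (fun z : measurableTypeR R * euc R d =>
    (\1_[set x : euc R d.+1 | \prod_(k < d.+1) ecoord x k = 0]
       (cons_tuple z.1 z.2))%:E)) => //.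
  by apply: (measurableT_comp mI); exact: measurable_consp.
- by move=> x _; exact: integral_ge0.
- exact: lebesgue_measure_set1.
apply: integral0_eq => x [_ /eqP x0].
rewrite -[RHS]IH indicE'; last exact: measurable_zero_coord.
apply: eq_integral => y _; congr EFin; rewrite !indicE; congr (nat_of_bool _)%:R.
apply/idP/idP; rewrite !inE /= big_ord_recl ecoord_cons0.
  move=> /eqP; rewrite mulf_eq0 (negbTE x0)/= => /eqP <-.
  by apply: eq_bigr => k _; rewrite ecoord_consS.
move=> H; apply/eqP; rewrite mulf_eq0; apply/orP; right; rewrite -[X in _ == X]H.
by apply/eqP; apply: eq_bigr => k _; rewrite ecoord_consS.
Qed.

Lemma ae_nonzero_coords d :
  {ae lebesgue d, forall x : euc R d, \prod_(k < d) ecoord x k != 0}.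
Proof.
exists [set x : euc R d | \prod_(k < d) ecoord x k = 0]; split.
- exact: measurable_zero_coord.
- exact: lebesgue_zero_coord.
- by move=> x /= /negP; rewrite negbK => /eqP.
Qed.

End hyperplanes.

Section fourier_bounds.
Local Open Scope complex_scope.
Context {R : realType} {d : nat}.
Implicit Types (e x xi : euc R d) (f g : euc R d -> R[i]).

(** Each real component of the damped transform is a signed sum of four tails,
    one for each Jordan component of mu, off the coordinate hyperplanes. *)
Lemma ae_sum4_Rintegral_le (F a1 a2 a3 a4 : euc R d -> R) (B : R) :
  measurable_fun setT F ->
  (forall x, \prod_(k < d) ecoord x k != 0 -> F x = a1 x - a2 x - a3 x + a4 x) ->
  (lebesgue d).-integrable setT (EFin \o a1) /\ `|\int[lebesgue d]_x a1 x| <= B ->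
  (lebesgue d).-integrable setT (EFin \o a2) /\ `|\int[lebesgue d]_x a2 x| <= B ->
  (lebesgue d).-integrable setT (EFin \o a3) /\ `|\int[lebesgue d]_x a3 x| <= B ->
  (lebesgue d).-integrable setT (EFin \o a4) /\ `|\int[lebesgue d]_x a4 x| <= B ->
  `|\int[lebesgue d]_x F x| <= 4 * B.
Proof.
move=> mF FE [i1 b1] [i2 b2] [i3 b3] [i4 b4].
have i12 : (lebesgue d).-integrable setT (EFin \o (fun x => a1 x - a2 x)).
  exact: (integrableB measurableT i1 i2).
have i123 : (lebesgue d).-integrable setT (EFin \o (fun x => a1 x - a2 x - a3 x)).
  exact: (integrableB measurableT i12 i3).
have i1234 : (lebesgue d).-integrable setT
    (EFin \o (fun x => a1 x - a2 x - a3 x + a4 x)).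
  exact: (integrableD measurableT i123 i4).
have -> : \int[lebesgue d]_x F x = \int[lebesgue d]_x (a1 x - a2 x - a3 x + a4 x).
  congr fine; apply: ae_eq_integral => //.
  - exact/measurable_EFinP.
  - by case/integrableP : i1234.
  - apply: filterS (ae_nonzero_coords d) => x x0 _; congr EFin; exact: FE.
rewrite RintegralD// RintegralB// RintegralB//.
apply: (le_trans (ler_normD _ _)).
have := ler_normB (\int[lebesgue d]_x a1 x - \int[lebesgue d]_x a2 x)
  (\int[lebesgue d]_x a3 x).
have := ler_normB (\int[lebesgue d]_x a1 x) (\int[lebesgue d]_x a2 x).
lra.
Qed.

Definition re_part f xi (E : euc R d -> R) x : R :=
  complex.Re (f x) * E x * cos (phase xi 0 x) -
  complex.Im (f x) * E x * sin (phase xi 0 x).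

Definition im_part f xi (E : euc R d -> R) x : R :=
  complex.Re (f x) * E x * sin (phase xi 0 x) +
  complex.Im (f x) * E x * cos (phase xi 0 x).

Definition damping e x : R := expR (- \sum_(k < d) ecoord e k * `|ecoord x k|).

Lemma fourier_epsE f e xi : fourier_eps f e xi =
  (\int[lebesgue d]_x re_part f xi (damping e) x) +i*
  (\int[lebesgue d]_x im_part f xi (damping e) x).
Proof.
rewrite /fourier_eps /cintegral; congr (_ +i* _); apply: eq_Rintegral => x _;
  rewrite /re_part /im_part /expi /damping /phase add0r;
  case: (f x) => a b /=; ring.
Qed.

Lemma fourierE f xi : fourier f xi =
  (\int[lebesgue d]_x re_part f xi (cst 1) x) +i*
  (\int[lebesgue d]_x im_part f xi (cst 1) x).
Proof.
rewrite /fourier /cintegral; congr (_ +i* _); apply: eq_Rintegral => x _;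
  rewrite /re_part /im_part /expi /phase add0r;
  case: (f x) => a b /=; ring.
Qed.

Lemma measurable_sin {disp} {T : measurableType disp} (h : T -> R) :
  measurable_fun setT h -> measurable_fun setT (fun z => sin (h z)).
Proof.
exact: (measurableT_comp (continuous_measurable_fun (@continuous_sin R))).
Qed.

Lemma measurable_damping e : measurable_fun setT (damping e).
Proof.
apply: (measurableT_comp (@measurable_expR R)); apply: measurable_funN.
apply: measurable_sum => k; apply: measurable_funM => //.
apply: (measurableT_comp (@normr_measurable R setT)).
exact: measurable_ecoord.
Qed.

Lemma measurable_re_part f xi E : cmeasurable setT f -> measurable_fun setT E ->
  measurable_fun setT (re_part f xi E).
Proof.
move=> [mr mi] mE; apply: measurable_funB; apply: measurable_funM => //;
  try exact: measurable_funM.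
- by apply: measurable_cos_affine; exact: measurable_phase.
- by apply: measurable_sin; exact: measurable_phase.
Qed.

Lemma measurable_im_part f xi E : cmeasurable setT f -> measurable_fun setT E ->
  measurable_fun setT (im_part f xi E).
Proof.
move=> [mr mi] mE; apply: measurable_funD; apply: measurable_funM => //;
  try exact: measurable_funM.
- by apply: measurable_sin; exact: measurable_phase.
- by apply: measurable_cos_affine; exact: measurable_phase.
Qed.

Section even_potential.
Variables (f g : euc R d -> R[i]) (mu : complex_radon R d) (xi : euc R d).
Hypotheses (Moo : forall r, orthant r -> (majorant mu r < +oo)%E)
  (gE : canonical_version g mu) (fg : even_extension g f)
  (xi0 : forall k, ecoord xi k != 0).

Let B := 4 * (8 ^+ d * fine (majorant mu (einv xi))).

Let fE x : \prod_(k < d) ecoord x k != 0 -> f x = cmeas mu (Qstar (eabs x)).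
Proof.
move=> x0; have [_ ->//] := fg; rewrite gE//.
by apply: eabs_orthant; exact/prod_neq0P.
Qed.

Let sin_phase x : sin (phase xi 0 x) = cos (phase xi (- (pi / 2)) x).
Proof.
rewrite /phase add0r cosD cosN sinN cos_pihalf sin_pihalf.
by rewrite mul0r sub0r mulN1r opprK.
Qed.

Lemma fourier_eps_le e : (forall k, 0 < ecoord e k) ->
  `|complex.Re (fourier_eps f e xi)| <= B /\ `|complex.Im (fourier_eps f e xi)| <= B.
Proof.
move=> e0; rewrite fourier_epsE /=.
have bnd (nu : {measure set (euc R d) -> \bar R}) th : component mu nu ->
    (lebesgue d).-integrable setT (EFin \o osc_tail nu e xi th) /\
    `|\int[lebesgue d]_x osc_tail nu e xi th x| <=
      8 ^+ d * fine (majorant mu (einv xi)).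
  by move=> cnu; exact: osc_tail_bound.
have [mf _] := fg; split.
- apply: (ae_sum4_Rintegral_le
    (a1 := osc_tail (re_plus mu) e xi 0) (a2 := osc_tail (re_minus mu) e xi 0)
    (a3 := osc_tail (im_plus mu) e xi (- (pi / 2)))
    (a4 := osc_tail (im_minus mu) e xi (- (pi / 2)))).
  + by apply: measurable_re_part => //; exact: measurable_damping.
  + move=> x x0; rewrite /re_part /osc_tail (negbTE x0) fE// -sin_phase /=.
    by rewrite /damping; ring.
  + by apply: bnd; exact: component_re_plus.
  + by apply: bnd; exact: component_re_minus.
  + by apply: bnd; exact: component_im_plus.
  + by apply: bnd; exact: component_im_minus.
- apply: (ae_sum4_Rintegral_le
    (a1 := osc_tail (re_plus mu) e xi (- (pi / 2)))
    (a2 := osc_tail (re_minus mu) e xi (- (pi / 2)))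
    (a3 := osc_tail (im_minus mu) e xi 0) (a4 := osc_tail (im_plus mu) e xi 0)).
  + by apply: measurable_im_part => //; exact: measurable_damping.
  + move=> x x0; rewrite /im_part /osc_tail (negbTE x0) fE// -sin_phase /=.
    by rewrite /damping; ring.
  + by apply: bnd; exact: component_re_plus.
  + by apply: bnd; exact: component_re_minus.
  + by apply: bnd; exact: component_im_minus.
  + by apply: bnd; exact: component_im_plus.
Qed.

End even_potential.

End fourier_bounds.

(** * Removing the damping *)

Section undamping.
Context {R : realType} {d : nat}.

Definition harmonic_point (n : nat) : euc R d := evec (fun=> n.+1%:R^-1).

Lemma damping_cvg1 (x : euc R d) :
  damping (harmonic_point n) x @[n --> \oo] --> (1 : R).
Proof.
have c0 : (- \sum_(k < d) ecoord (harmonic_point n) k * `|ecoord x k|) @[n --> \oo]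
    --> (0 : R).
  rewrite -[X in _ --> X]oppr0; apply: cvgN.
  rewrite (_ : (fun n => _) = fun n => harmonic n * \sum_(k < d) `|ecoord x k|).
    rewrite -[X in _ --> X](mul0r (\sum_(k < d) `|ecoord x k|)).
    by apply: cvgM; [exact: cvg_harmonic|exact: cvg_cst].
  apply/funext => n; rewrite mulr_sumr; apply: eq_bigr => k _.
  by rewrite ecoord_evec.
rewrite -[X in _ --> X]expR0.
have cE : {for (0:R), continuous (@expR R)} by exact: continuous_expR.
exact: (continuous_cvg _ cE c0).
Qed.

(** Dominated convergence along the damping parameters (1/(n+1), ..., 1/(n+1)). *)
Lemma undamped_integral_le (h : euc R d -> R) (B : R) :
  (lebesgue d).-integrable setT (EFin \o h) ->
  (forall e, (forall k, 0 < ecoord e k) ->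
     `|\int[lebesgue d]_x (h x * damping e x)| <= B) ->
  `|\int[lebesgue d]_x h x| <= B.
Proof.
move=> ih hB; have [mh hoo] := integrableP _ _ _ ih.
have mhR : measurable_fun setT h by exact/measurable_EFinP.
have damp1 n x : `|damping (harmonic_point n) x| <= 1.
  rewrite /damping ger0_norm ?expR_ge0// -[leRHS]expR0 ler_expR oppr_le0.
  by apply: sumr_ge0 => k _; rewrite ecoord_evec mulr_ge0// invr_ge0.
pose f_ (n : nat) (x : euc R d) := (h x * damping (harmonic_point n) x)%:E.
have mf_ n : measurable_fun setT (f_ n).
  by apply/measurable_EFinP; apply: measurable_funM => //; exact: measurable_damping.
have f_le n x : (`|f_ n x| <= `|(h x)%:E|)%E.
  by rewrite !abse_EFin lee_fin normrM ler_piMr.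
have f_cvg x : f_ n x @[n --> \oo] --> (h x)%:E.
  apply: cvg_EFin; first by apply: nearW.
  rewrite -[X in _ --> X](mulr1 (h x)).
  by apply: cvgM; [exact: cvg_cst|exact: damping_cvg1].
have iabs : (lebesgue d).-integrable setT (fun x => `|(h x)%:E|)%E.
  exact: integrable_abse.
have [_ _ cv] := dominated_convergence measurableT mf_ mh
  (aeW _ (fun x _ => f_cvg x)) iabs (aeW _ (fun x n _ => f_le n x)).
have fin_h : (\int[lebesgue d]_x (h x)%:E)%E \is a fin_num.
  exact: integrable_fin_num.
rewrite -lee_fin -abse_EFin /Rintegral fineK//.
have cva := @cvg_abse _ _ eventually_filter R _ _ cv.
rewrite -(cvg_lim _ cva)//; apply: lime_le.
  by apply/cvg_ex; eexists; exact: cva.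
apply: nearW => n /=.
have fin_n : (\int[lebesgue d]_x f_ n x)%E \is a fin_num.
  apply: integrable_fin_num => //.
  exact: (le_integrable measurableT (mf_ n) (fun x _ => f_le n x) ih).
rewrite -[X in `|X|%E]fineK// abse_EFin lee_fin.
apply: hB => k; by rewrite ecoord_evec invr_gt0.
Qed.

Lemma cabs_le_ReIm (z : R[i]) : cabs z <= `|complex.Re z| + `|complex.Im z|.
Proof.
case: z => a b /=.
rewrite -[leRHS]ger0_norm ?addr_ge0// -sqrtr_sqr ler_sqrt ?sqr_ge0//.
rewrite sqrrD -!normrX !(ger0_norm (sqr_ge0 _)).
by rewrite -addrA lerD2l lerDr mulrn_wge0// mulr_ge0.
Qed.

End undamping.

Section limits.
Local Open Scope complex_scope.
Context {R : realType} {d : nat}.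

#[local] Instance at_0plus_proper : ProperFilter (@at_0plus R d).
Proof.
apply: filter_from_proper.
  apply: filter_from_filter; first by exists 1 => /=.
  move=> i j /= i0 j0; exists (Num.min i j); first by rewrite /= lt_min i0.
  by move=> e H; split=> k; have /andP[-> /=] := H k; rewrite lt_min => /andP[].
move=> i /= i0; exists (evec (fun=> i / 2)) => k; rewrite ecoord_evec.
by rewrite divr_gt0//= ltr_pdivrMr// ltr_pMr// ltr1n.
Qed.

(** A bound valid for all admissible parameters passes to the limit, the filter
    being proper. *)
Lemma cabs_lim_at_0plus (F : euc R d -> R[i]) (B : R) : 0 <= B ->
  (forall e, (forall k, 0 < ecoord e k) -> cabs (F e) <= B) ->
  cabs (lim ((F e : (R[i] : numFieldType)) @[e --> at_0plus])) <= B.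
Proof.
move=> B0 FB.
have [cF|ncF] := pselect (cvg ((F e : (R[i] : numFieldType)) @[e --> at_0plus]));
  (* without a limit, lim takes the default value 0 *)
  last by rewrite (dvgP ncF) ComplexField.Normc.normc0.
set l := lim _; rewrite leNgt; apply/negP => Bl.
have eps0 : (0 : R[i]) < (cabs l - B)%:C by rewrite ltcR subr_gt0.
have /cvgrPdist_lt/(_ _ eps0) := cF.
rewrite -/l => near_l.
have near_pos : \forall e \near (@at_0plus R d), forall k, 0 < ecoord e k.
  by exists 1 => //= e He k; have /andP[] := He k.
have [e [e0 le]] := @filter_ex _ _ at_0plus_proper _ (filterI near_pos near_l).
move: le; rewrite /= -[`|_|]/((cabs (l - F e))%:C) ltcR => le.
have : cabs l <= cabs (l - F e) + cabs (F e).
  by rewrite -{1}(subrK (F e) l); exact: (@le_normcD R (l - F e) (F e)).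
have := FB e e0; lra.
Qed.

End limits.

(** * Fourier transforms, majorants and the mixed norm inequality *)

Lemma measurable_cabs {R : realType} {d : nat} (f : euc R d -> R[i]) :
  cmeasurable setT f -> measurable_fun setT (fun x => cabs (f x)).
Proof.
move=> [mr mi].
have -> : (fun x => cabs (f x)) = (fun x =>
    (complex.Re (f x) ^+ 2 + complex.Im (f x) ^+ 2) `^ 2^-1).
  apply/funext => x; rewrite powR12_sqrt ?addr_ge0 ?sqr_ge0//.
  by case: (f x).
apply: (measurableT_comp (measurable_powR _)).
by apply: measurable_funD; exact: measurable_funX.
Qed.

Section pointwise_bound.
Context {R : realType} {d : nat}.
Variables (K : R) (lambda : euc R d) (f g : euc R d -> R[i])
  (mu : complex_radon R d).
Hypotheses (gpot : upper_tail_potential g mu) (gE : canonical_version g mu)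
  (gK : forall r, orthant r ->
    (majorant mu r <= K%:E * \int[lebesgue d]_(x in
       Qbox (evec (fun k => ecoord lambda k * ecoord r k)%R)) (cabs (g x))%:E)%E)
  (fg : even_extension g f).

Let Moo r : orthant r -> (majorant mu r < +oo)%E.
Proof. by case: gpot => _ _; exact. Qed.

(** The RMGM condition at r = 1/|xi|, rewritten for f, which agrees with g on the
    orthant. *)
Lemma majorant_le_box_integral (xi : euc R d) : (forall k, ecoord xi k != 0) ->
  (majorant mu (einv xi) <=
   K%:E * box_integral lambda (fun x => (cabs (f x))%:E) xi)%E.
Proof.
move=> xi0; apply: (le_trans (gK (orthant_einv xi0))).
rewrite le_eqVlt; apply/orP; left; apply/eqP; congr (_ * _)%E.
rewrite /box_integral (_ : evec (fun k => ecoord lambda k * _) =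
  evec (fun k => ecoord lambda k / `|ecoord xi k|)); last first.
  by congr evec; apply/funext => k; rewrite ecoord_evec.
apply: eq_integral => x; rewrite inE => xQ; congr (cabs _)%:E.
have x0 k : 0 < ecoord x k by have /andP[] := xQ k.
have [_ ->] := fg; last by apply/prod_neq0P => k; rewrite gt_eqF.
congr g; apply: eq_from_tnth => k.
by rewrite -[RHS]/(ecoord _ k) ecoord_evec gtr0_norm.
Qed.

(* 8^d for the boxes, 4 for the Jordan components, 2 for the real and imaginary
   parts. *)
Let c : R := 8 * 8 ^+ d.

Lemma abel_fourier_le (xi : euc R d) : (forall k, ecoord xi k != 0) ->
  ((cabs (abel_fourier f xi))%:E <=
   (c * K)%:E * box_integral lambda (fun x => (cabs (f x))%:E) xi)%E.
Proof.
move=> xi0; have oxi := orthant_einv xi0.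
apply: (@le_trans _ _ (c%:E * majorant mu (einv xi))%E); last first.
  rewrite [(c * K)%:E]EFinM -muleA.
  apply: lee_wpmul2l; last exact: majorant_le_box_integral.
  by rewrite lee_fin mulr_ge0// exprn_ge0.
have M0 := majorant_ge0 mu oxi.
rewrite -[majorant _ _]fineK ?ge0_fin_numE ?Moo// -EFinM lee_fin.
rewrite /abel_fourier ifN; last exact/prod_neq0P.
apply: cabs_lim_at_0plus => [|e e0].
  by rewrite mulr_ge0 ?fine_ge0// mulr_ge0// exprn_ge0.
apply: (le_trans (cabs_le_ReIm _)).
have [h1 h2] := fourier_eps_le Moo gE fg xi0 e0.
by apply: (le_trans (lerD h1 h2)); rewrite /c; lra.
Qed.

Lemma fourier_le (xi : euc R d) : integrable_L1 f -> (forall k, ecoord xi k != 0) ->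
  ((cabs (fourier f xi))%:E <=
   (c * K)%:E * box_integral lambda (fun x => (cabs (f x))%:E) xi)%E.
Proof.
move=> [mf foo] xi0; have oxi := orthant_einv xi0.
apply: (@le_trans _ _ (c%:E * majorant mu (einv xi))%E); last first.
  rewrite [(c * K)%:E]EFinM -muleA.
  apply: lee_wpmul2l; last exact: majorant_le_box_integral.
  by rewrite lee_fin mulr_ge0// exprn_ge0.
have M0 := majorant_ge0 mu oxi.
rewrite -[majorant _ _]fineK ?ge0_fin_numE ?Moo// -EFinM lee_fin.
set B := 4 * (8 ^+ d * fine (majorant mu (einv xi))).
have m1 : measurable_fun setT (cst 1 : euc R d -> R) by exact: measurable_cst.
have [mfr mfi] := mf.
have int_part (h : euc R d -> R) : measurable_fun setT h ->
    (forall x, `|h x| <= 2 * cabs (f x)) ->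
    (lebesgue d).-integrable setT (EFin \o h).
  move=> mh hle; apply/integrableP; split; first exact/measurable_EFinP.
  apply: (@le_lt_trans _ _ (\int[lebesgue d]_x (2%:E * (cabs (f x))%:E))%E).
    apply: le_integral_nonneg => x; first exact: abse_ge0.
    by rewrite /= -EFinM lee_fin.
  rewrite integralZ_nonneg// => [|x]; last first.
    by rewrite lee_fin (le_trans _ (normr_Re_le _)).
  by rewrite lte_mul_pinfty// ?lee_fin.
have [hr hi] : `|complex.Re (fourier f xi)| <= B /\ `|complex.Im (fourier f xi)| <= B.
  rewrite fourierE /=; split; apply: undamped_integral_le.
  - apply: int_part => [|x]; first exact: measurable_re_part.
    rewrite /re_part !mulr1 mulr_natl mulr2n; apply: (le_trans (ler_normB _ _)).
    rewrite !normrM; apply: lerD.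
      by apply: le_trans (normr_Re_le _); rewrite ler_piMr// cos_max.
    by apply: le_trans (normr_Im_le _); rewrite ler_piMr// sin_max.
  - move=> e e0; have [+ _] := fourier_eps_le Moo gE fg xi0 e0.
    rewrite fourier_epsE /=; congr (`|_| <= _); apply: eq_Rintegral => x _.
    by rewrite /re_part /=; ring.
  - apply: int_part => [|x]; first exact: measurable_im_part.
    rewrite /im_part !mulr1 mulr_natl mulr2n; apply: (le_trans (ler_normD _ _)).
    rewrite !normrM; apply: lerD.
      by apply: le_trans (normr_Re_le _); rewrite ler_piMr// sin_max.
    by apply: le_trans (normr_Im_le _); rewrite ler_piMr// cos_max.
  - move=> e e0; have [_] := fourier_eps_le Moo gE fg xi0 e0.
    rewrite fourier_epsE /=; congr (`|_| <= _); apply: eq_Rintegral => x _.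
    by rewrite /im_part /=; ring.
apply: (le_trans (cabs_le_ReIm _)).
by apply: (le_trans (lerD hr hi)); rewrite /B /c; lra.
Qed.

End pointwise_bound.

Lemma cabs_weighted {R : realType} {d : nat} (rho : euc R d)
    (F : euc R d -> R[i]) x :
  cabs (weighted rho F x) = weight rho x * cabs (F x).
Proof.
rewrite /weighted ComplexField.Normc.normcM; congr (_ * _).
by rewrite /= expr0n addr0 sqrtr_sqr ger0_norm// weight_ge0.
Qed.

Theorem theorem4p1 (R : realType) (d : nat) (p q alpha lambda : euc R d)
    (K : R) :
  (0 < d)%N ->
  (forall k, 1 <= ecoord p k <= ecoord q k) ->
  (forall k, - (ecoord q k)^-1 < ecoord alpha k) ->
  1 <= K ->
  (forall k, 1 <= ecoord lambda k) ->
  let beta : euc R d :=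
    evec (fun k => 1 - (ecoord p k)^-1 - (ecoord q k)^-1 - ecoord alpha k) in
  exists C : R, forall g f : euc R d -> R[i],
    RMGM K lambda g ->
    even_extension g f ->
    in_mixed_L p (weighted beta f) ->
    (mixed_norm q (weighted alpha (abel_fourier f))
       <= C%:E * mixed_norm p (weighted beta f))%E /\
    (integrable_L1 f ->
     (mixed_norm q (weighted alpha (fourier f))
        <= C%:E * mixed_norm p (weighted beta f))%E).
Proof.
move=> _ pq qa K1 lam1 beta.
have K0 : 0 <= K by exact: le_trans K1.
have lam0 k : 0 < ecoord lambda k by exact: lt_le_trans (lam1 k).
have q0 k : 0 < ecoord q k.
  by have /andP[p1 /(le_trans p1)] := pq k; exact: lt_le_trans.
have [C C0 hardyC] := mixed_hardy pq qa lam0.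
pose c : R := 8 * 8 ^+ d * K.
have c0 : 0 <= c by rewrite mulr_ge0// mulr_ge0// exprn_ge0.
exists (c * C) => g f [mu [gpot gE gK]] fg _.
have mf : measurable_fun setT (fun x => (cabs (f x))%:E).
  by apply/measurable_EFinP; apply: measurable_cabs; case: fg.
have f0 x : (0 <= (cabs (f x))%:E)%E.
  by rewrite lee_fin (le_trans _ (normr_Re_le _)).
have main (F : euc R d -> R[i]) :
    (forall xi, (forall k, ecoord xi k != 0) -> ((cabs (F xi))%:E <=
       c%:E * box_integral lambda (fun x => (cabs (f x))%:E) xi)%E) ->
    (mixed_norm q (weighted alpha F) <=
      (c * C)%:E * mixed_norm p (weighted beta f))%E.
  move=> FB; apply: (@le_trans _ _ (mixed_norm_rec q (fun xi => c%:E *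
      ((weight alpha xi)%:E * box_integral lambda (fun x => (cabs (f x))%:E) xi)))%E).
    apply: le_mixed_norm_rec => // xi; first by rewrite lee_fin (le_trans _ (normr_Re_le _)).
    rewrite cabs_weighted EFinM.
    have [xi0|/prod_neq0P xi0] := eqVneq (\prod_(k < d) ecoord xi k) 0.
      by rewrite /weight xi0 eqxx !mul0e mule0.
    by rewrite muleCA; apply: lee_wpmul2l; [rewrite lee_fin weight_ge0|exact: FB].
  rewrite mixed_norm_recZ//; last first.
    by move=> xi; rewrite mule_ge0 ?lee_fin ?weight_ge0// integral_ge0.
  rewrite [(c * C)%:E]EFinM -muleA; apply: lee_wpmul2l; first by rewrite lee_fin.
  apply: (le_trans (hardyC _ mf f0)); rewrite -/beta.
  rewrite /mixed_norm le_eqVlt; apply/orP; left; apply/eqP; congr (_ * _)%E.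
  by congr mixed_norm_rec; apply/funext => x; rewrite cabs_weighted EFinM.
split; first by apply: main => xi xi0; exact: (abel_fourier_le gpot gE gK fg).
by move=> fL1; apply: main => xi xi0; exact: (fourier_le gpot gE gK fg).
Qed.
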